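(* Let $n\ge 2$, let $G\subset\mathbb{R}^n$ be an open set with $\mathcal{L}^n(\partial G)=0$, let $L\in[0,\mathrm{Per}(G))$ and $A\in[0,\mathcal{L}^n(G))$. (i) If $E\subset\overline{G}$ is a solution of problem $(P)$ for the value $L$, then $E$ has minimal perimeter among all subsets of $G$ which have the same volume $\mathcal{L}^n(E)$. (ii) If $F\subset\overline{G}$ is a solution of problem $(P_* )$ for the value $A$, then $F$ has maximal volume among all subsets of $G$ which have the same perimeter $\mathrm{Per}(F)$.
   Context: $\mathcal{L}^n$ denotes Lebesgue measure on $\mathbb{R}^n$. For an $\mathcal{L}^n$-measurable set $E\subset\mathbb{R}^n$, the perimeter (relative to the whole space $\mathbb{R}^n$) is $$\mathrm{Per}(E):=\sup\left\{\int_E \mathrm{div}\,\varphi\,dx : \varphi\in C^1_0(\mathbb{R}^n,\mathbb{R}^n),\ |\varphi|\le 1\right\}\in[0,\infty],$$ where $C^1_0$ denotes compactly supported $C^1$ fields. All subsets considered (solutions and competitors) are Lebesgue measurable with finite Lebesgue measure, i.e. their characteristic functions are regarded as elements of $L^1(\mathbb{R}^n)$; the region $G$ itself may have infinite measure and infinite perimeter. Competitors differing by Lebesgue null sets have the same volume and perimeter, and since $\mathcal{L}^n(\partial G)=0$ it makes no difference whether competitors are taken in $G$ or in $\overline{G}$. Problem $(P)$: given $L\in[0,\mathrm{Per}(G))$, find a subset $E\subset\overline{G}$ with $\mathrm{Per}(E)=L$ and such that $\mathcal{L}^n(E)$ is maximal (among all subsets of $\overline{G}$ with perimeter $L$). Problem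 $(P_* )$: given $A\in[0,\mathcal{L}^n(G))$, find a subset $E\subset\overline{G}$ with $\mathcal{L}^n(E)=A$ and such that $\mathrm{Per}(E)$ is minimal (among all subsets of $\overline{G}$ with volume $A$). *)

(* Defs.v *)
From HB Require Import structures.
From mathcomp Require Import all_boot all_order all_algebra.
From mathcomp Require Import all_classical all_reals all_analysis.
Set Implicit Arguments.
Unset Strict Implicit.
Unset Printing Implicit Defensive.
Import Order.TTheory GRing.Theory Num.Theory.
Import numFieldNormedType.Exports.
Local Open Scope classical_set_scope.
Local Open Scope ring_scope.

(* Points of R^n are row vectors 'rV[R]_n.  Their library topology is the usual
   one, but the library norm `|x| is the sup norm: see [enorm]. *)

Section lebesgue_outer_measure.
Context {R : realType} {n : nat}.
Local Open Scope ereal_scope.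

Definition box (Q : 'rV[R]_n * 'rV[R]_n) : set 'rV[R]_n :=
  [set x | forall i, (Q.1 ord0 i < x ord0 i <= Q.2 ord0 i)%R].

Definition box_vol (Q : 'rV[R]_n * 'rV[R]_n) : R :=
  (\prod_i Num.max 0 (Q.2 ord0 i - Q.1 ord0 i))%R.

(* [None] is an explicit empty box, so that finite covers are also sequences
   (this matters only for n = 0, where no pair of corners has an empty box). *)
Definition obox (Q : option ('rV[R]_n * 'rV[R]_n)) : set 'rV[R]_n :=
  oapp box set0 Q.

Definition obox_vol (Q : option ('rV[R]_n * 'rV[R]_n)) : R := oapp box_vol 0%R Q.

Definition leb_outer (A : set 'rV[R]_n) : \bar R :=
  ereal_inf [set \sum_(k <oo) (obox_vol (Q k))%:E |
    Q in [set Q : nat -> option ('rV[R]_n * 'rV[R]_n) |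
            A `<=` \bigcup_k obox (Q k)]].

Lemma obox_vol_ge0 Q : 0 <= (obox_vol Q)%:E.
Proof.
rewrite lee_fin; case: Q => [Q|] //=.
by apply: prodr_ge0 => i _; rewrite le_max lexx.
Qed.

Lemma leb_outer_ge0 A : 0 <= leb_outer A.
Proof.
apply: le_ereal_inf_tmp => _ [Q _ <-].
by apply: nneseries_ge0 => k _ _; exact: obox_vol_ge0.
Qed.

Lemma leb_outer0 : leb_outer set0 = 0.
Proof.
apply/eqP; rewrite eq_le leb_outer_ge0 andbT.
apply: ereal_inf_lbound; exists (fun=> None); first exact: sub0set.
by rewrite eseries0.
Qed.

Lemma le_leb_outer : {homo leb_outer : A B / A `<=` B >-> A <= B}.
Proof.
move=> A B AB; apply/ereal_inf_le_tmp => _ [Q BQ <-].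
by exists Q => //; exact: subset_trans BQ.
Qed.

Lemma leb_outer_sigma_subadditive : sigma_subadditive leb_outer.
Proof.
move=> A; have [[i ioo]|] := pselect (exists i, leb_outer (A i) = +oo).
  rewrite (eseries_pinfty _ _ ioo) ?leey// => k _.
  by rewrite -ltNye (lt_le_trans _ (leb_outer_ge0 _)).
rewrite -forallNE => Aoo.
apply/lee_addgt0Pr => _/posnumP[e].
rewrite (le_trans _ (epsilon_trick _ _ _))//; last first.
  by move=> k; exact: leb_outer_ge0.
pose P k (Q : nat -> option ('rV[R]_n * 'rV[R]_n)) :=
  A k `<=` \bigcup_j obox (Q j) /\
  \sum_(j <oo) (obox_vol (Q j))%:E <=
    leb_outer (A k) + (e%:num / (2 ^ k.+1)%:R)%:E.
have [G PG] : {G : nat -> nat -> option ('rV[R]_n * 'rV[R]_n)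
               & forall k, P k (G k)}.
  apply: (@choice _ _ P) => k; rewrite /P.
  have en1 : (0 < e%:num / (2 ^ k.+1)%:R)%R by [].
  have fA : leb_outer (A k) \is a fin_num.
    by rewrite ge0_fin_numE ?leb_outer_ge0// ltey; apply/eqP; exact: Aoo.
  have [_ [Q AQ <-] Qlt] := lb_ereal_inf_adherent en1 fA.
  by exists Q; split=> //; exact/ltW.
pose v (kj : nat * nat) := (obox_vol (G kj.1 kj.2))%:E.
have v_ge0 x : 0 <= v x by exact: obox_vol_ge0.
apply: (@le_trans _ _ (\esum_(i in setT) v i)).
  apply: ereal_inf_lbound => /=.
  have /card_esym/ppcard_eqP[f] := card_nat2.
  exists (fun i => G (f i).1 (f i).2).
    move=> t [k _] /(PG k).1 [j _ Qt]; exists (f^-1%FUN (k, j)) => //=.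
    by rewrite invK ?inE.
  rewrite -[LHS]/(\sum_(i <oo) v (f i)).
  rewrite -(esum_pred_image v _ xpredT) ?[fun=> _]set_true//.
  by rewrite image_eq.
rewrite (_ : esum _ _ = \sum_(i <oo) \sum_(j <oo) v (i, j)); last first.
  pose J : nat -> set (nat * nat) := fun i => [set (i, j) | j in setT].
  rewrite (_ : setT = \bigcup_k J k); last first.
    by rewrite predeqE => -[a b]; split => // _; exists a => //; exists b.
  rewrite esum_bigcupT /=; last 2 first.
  - apply/trivIsetP => i j _ _ ij.
    rewrite predeqE => -[p m] /=; split => //= -[] [_] _ [<-{p} _].
    by move=> [m' _] [] /esym/eqP; rewrite (negbTE ij).
  - by move=> ?; exact: v_ge0.
  rewrite -(image_id [set: nat]) -fun_true esum_pred_image//; last first.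
    by move=> k _; exact: esum_ge0.
  apply: eq_eseriesr => /= j _.
  rewrite -(esum_pred_image v (pair j) predT)//=; last first.
    by move=> ? ? _ _; exact: (@can_inj _ _ _ snd).
  by congr esum; rewrite predeqE => -[a b]; split; move=> [i _ <-]; exists i.
apply: lee_nneseries.
- by move=> k _ _; apply: nneseries_ge0 => m *; exact: v_ge0.
- by move=> k _; exact: (PG k).2.
Qed.

HB.instance Definition _ := isOuterMeasure.Build R _ leb_outer
  leb_outer0 leb_outer_ge0 le_leb_outer leb_outer_sigma_subadditive.

End lebesgue_outer_measure.
Arguments leb_outer : clear implicits.

(* Lebesgue measurable = Caratheodory measurable for the outer measure, and
   L^n = the restriction of the outer measure to these sets. *)
Definition leb (R : realType) (n : nat)
  (E : set (caratheodory_type (leb_outer R n))) : \bar R := leb_outer R n E.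
Arguments leb : clear implicits.

HB.instance Definition _ (R : realType) (n : nat) := isMeasure.Build _ _ _
  (leb R n) (@caratheodory_measure0 _ _ (leb_outer R n))
  (@caratheodory_measure_ge0 _ _ (leb_outer R n))
  (@caratheodory_measure_sigma_additive _ _ (leb_outer R n)).

Definition leb_measurable (R : realType) (n : nat) (E : set 'rV[R]_n) : Prop :=
  (leb_outer R n).-cara.-measurable E.

Section perimeter.
Context {R : realType} {n : nat}.
Implicit Types (phi : 'rV[R]_n -> 'rV[R]_n) (E F G Omega : set 'rV[R]_n).

Definition enorm (v : 'rV[R]_n) : R := Num.sqrt (\sum_i v ord0 i ^+ 2).

Definition C1 phi : Prop :=
  (forall x, differentiable phi x) /\ (forall v, continuous ('D_v phi)).

Definition compact_support phi : Prop :=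
  compact (closure [set x | phi x != 0]).

Definition divergence phi (x : 'rV[R]_n) : R :=
  \sum_i 'D_(delta_mx ord0 i) (fun y => phi y ord0 i) x.

Definition test_field phi : Prop :=
  [/\ C1 phi, compact_support phi & forall x, enorm (phi x) <= 1].

Definition Per E : \bar R :=
  ereal_sup [set (\int[leb R n]_(x in E) (divergence phi x)%:E)%E |
              phi in test_field].

Definition boundary G : set 'rV[R]_n := closure G `\` interior G.

Definition competitor Omega E : Prop :=
  [/\ leb_measurable E, E `<=` Omega & (leb R n E < +oo)%E].

Definition solution_P G (L : R) E : Prop :=
  [/\ competitor (closure G) E, Per E = L%:E &
      forall F, competitor (closure G) F -> Per F = L%:E ->
        (leb R n F <= leb R n E)%E].

Definition solution_Pstar G (A : R) E : Prop :=
  [/\ competitor (closure G) E, leb R n E = A%:E &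
      forall F, competitor (closure G) F -> leb R n F = A%:E ->
        (Per E <= Per F)%E].

End perimeter.

(* Main.v *)
Require Import Defs.
From mathcomp Require Import all_boot all_order all_algebra.
From mathcomp Require Import all_classical all_reals all_analysis.
From mathcomp Require Import measurable_realfun ring lra.
Import Order.TTheory GRing.Theory Num.Theory.
Import numFieldNormedType.Exports.
Local Open Scope classical_set_scope.
Local Open Scope ring_scope.

(* Everything is done with explicit radial competitors in the
   supremum defining [Per]; no coarea formula, mollification or structure theory
   of sets of finite perimeter is needed.  For a ball of radius t the field
   W(x) = 2 t x / (|x|^2 + t^2) satisfies |W| <= 1, W = x / t on the sphere
   |x| = t, and, since n >= 2, 0 < div W <= 2 n / t.  Gluing W to a test field
   through a thin radial transition at the sphere costs nothing in the limit,
   because W is there the outer normal; this gives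
     Per (A `|` B_t) <= Per A + (2 n / t) |B_t `\` A|,
     Per (E `&` B_r) + \int_(E `\` B_r) div W <= Per E    (|E| < oo),
   where in the second one W is also cut off far away (see [Per_setI_eball]).
   (i) If Per F < L < Per G, add to F the rational balls contained in G one by
   one until the perimeter exceeds L.  The perimeter is lower semicontinuous from
   the left and, by the first inequality, upper semicontinuous from the right in
   the radius of the last ball, hence it takes the value L exactly.  The set
   obtained has volume > |F|.
   (ii) By the second inequality, cutting a set E of finite perimeter with a ball
   strictly decreases its perimeter, and the volume of the trace of the ball takes
   all values in [0, |E|).  Cutting a finite union of balls in G the same way also
   shows that a minimizer has finite perimeter. *)

(** * Lebesgue measure and Euclidean balls *)

Section lebesgue_measure_rV.
Context {R : realType} {n : nat}.
Implicit Types (x c : 'rV[R]_n) (A B : set 'rV[R]_n).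

(** Pulling a cover back under the homothety divides every edge of every box by [k]. The inequality
    suffices: translations and scalings between balls are always used in both directions or only as
    upper bounds. *)
Lemma leb_outer_homothety (k : R) c A : 0 < k ->
  (leb_outer R n ((fun x => (k *: x + c)%R) @^-1` A)
     <= (k^-1 ^+ n)%:E * leb_outer R n A)%E.
Proof.
move=> k0; have kn0 : 0 < k ^+ n by exact: exprn_gt0.
rewrite exprVn lee_pdivlMl//; apply: le_ereal_inf_tmp => _ [Q AQ <-].
rewrite -lee_pdivlMl// -nneseriesZl; last by move=> i _; exact: obox_vol_ge0.
apply: ereal_inf_lbound.
pose f (q : 'rV[R]_n * 'rV[R]_n) := (k^-1 *: (q.1 - c), k^-1 *: (q.2 - c)).
exists (fun i => omap f (Q i)).
  move=> x /AQ[i _ xQ]; exists i => //; move: xQ; case: (Q i) => [q|]//= xq j.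
  have := xq j; rewrite !mxE => /andP[h1 h2].
  by rewrite ltr_pdivrMl// ler_pdivlMl// ltrBlDr lerBrDr h1 h2.
apply: eq_eseriesr => i _; rewrite -EFinM; congr _%:E.
case: (Q i) => [q|]/=; last by rewrite mulr0.
rewrite /box_vol.
have -> : (k ^+ n)^-1 = \prod_(j < n) k^-1 by rewrite prodr_const card_ord exprVn.
rewrite -big_split/=; apply: eq_bigr => j _.
by rewrite !mxE -mulrBr opprB addrA subrK maxr_pMr ?mulr0// ?invr_ge0 ltW.
Qed.

Lemma leb_outer_shift c A :
  leb_outer R n ((fun x => x + c) @^-1` A) = leb_outer R n A.
Proof.
have H d B : (leb_outer R n ((fun x => (x + d)%R) @^-1` B) <= leb_outer R n B)%E.
  have := leb_outer_homothety 1 d B ltr01; rewrite invr1 expr1n mul1e.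
  by under eq_fun do rewrite scale1r.
apply/eqP; rewrite eq_le H/=.
apply: le_trans (H (- c) _); apply: le_leb_outer => x Ax /=.
by rewrite addrNK.
Qed.

(** Splitting [X] by the translate of [A] is the translate of splitting a translate of [X] by [A],
    and the outer measure is translation invariant. *)
Lemma measurable_shift c A : leb_measurable A -> leb_measurable ((fun x => x + c) @^-1` A).
Proof.
move=> mA; apply: le_caratheodory_measurable => X.
have e := mA ((fun x => x - c) @^-1` X).
rewrite -[leRHS](leb_outer_shift (- c)) [leRHS]e; apply: leeD.
- rewrite -[leLHS](leb_outer_shift (- c)); apply: le_leb_outer => x [Xx /= h].
  by split => //; move: h; rewrite /= addrNK.
- rewrite -[leLHS](leb_outer_shift (- c)); apply: le_leb_outer => x [Xx /= h].
  by split => // Ax; apply: h; rewrite /= addrNK.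
Qed.

(** Every box of a cover is cut along the hyperplane. If the hyperplane misses the box, one piece
    has a reversed edge, to which [box_vol] gives length 0, so the two volumes always add up
    exactly. *)
Lemma measurable_halfspace (i : 'I_n) (a : R) :
  leb_measurable [set x : 'rV[R]_n | x ord0 i <= a].
Proof.
apply: le_caratheodory_measurable => X.
apply: le_ereal_inf_tmp => _ [Q XQ <-].
pose lo (q : 'rV[R]_n * 'rV[R]_n) : 'rV[R]_n * 'rV[R]_n :=
  (q.1, \row_j if j == i then Num.min (q.2 ord0 j) a else q.2 ord0 j).
pose hi (q : 'rV[R]_n * 'rV[R]_n) : 'rV[R]_n * 'rV[R]_n :=
  (\row_j if j == i then Num.max (q.1 ord0 j) a else q.1 ord0 j, q.2).
have -> : (\sum_(k <oo) (obox_vol (Q k))%:E =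
    \sum_(k <oo) (obox_vol (omap lo (Q k)))%:E +
    \sum_(k <oo) (obox_vol (omap hi (Q k)))%:E)%E.
  rewrite -nneseriesD; try by move=> *; exact: obox_vol_ge0.
  apply: eq_eseriesr => k _; rewrite -EFinD; congr _%:E.
  case: (Q k) => [q|]/=; last by rewrite addr0.
  rewrite /box_vol !(@bigD1 _ _ _ _ i xpredT)//=.
  rewrite !mxE eqxx.
  set p := \prod_(j < n | j != i) _.
  rewrite (_ : \prod_(j < n | j != i) _ = p); last first.
    by apply: eq_bigr => j ji; rewrite mxE (negbTE ji).
  rewrite (_ : \prod_(j < n | j != i) _ = p); last first.
    by apply: eq_bigr => j ji; rewrite mxE (negbTE ji).
  rewrite -mulrDl; congr (_ * _); move: (q.1 _ _) (q.2 _ _) => u v.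
  by rewrite /Num.max /Num.min; repeat case: ifPn; rewrite -?leNgt; lra.
apply: leeD; apply: ereal_inf_lbound.
- exists (fun k => omap lo (Q k)) => //.
  move=> x [/XQ[k _ xQ] xa]; exists k => //; move: xQ; case: (Q k) => [q|]//= xq j.
  have /andP[h1 h2] := xq j; rewrite h1 mxE; case: eqP => [ji|//].
  by rewrite le_min h2 ji.
- exists (fun k => omap hi (Q k)) => //.
  move=> x [/XQ[k _ xQ] /negP xa]; exists k => //; move: xQ; case: (Q k) => [q|]//= xq j.
  have /andP[h1 h2] := xq j; rewrite h2 mxE; case: eqP => [ji|]; last by rewrite h1.
  by rewrite gt_max h1 ji ltNge xa.
Qed.

Lemma measurable_fun_coord (i : 'I_n) :
  measurable_fun setT (fun x : caratheodory_type (leb_outer R n) => (x : 'rV[R]_n) ord0 i).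
Proof.
apply: (measurability _ (RGenOInfty.measurableE R)) => _ [_ [a ->] <-].
rewrite setTI.
rewrite (_ : _ @^-1` _ = ~` [set x : 'rV[R]_n | x ord0 i <= a]).
  exact/measurableC/measurable_halfspace.
by apply/seteqP; split => x /=; rewrite in_itv/= andbT ltNge => /negP.
Qed.

(** The squared Euclidean distance is a polynomial, hence C^1 also at the centre; all radial
    functions below are functions of it. *)
Definition sqdist c x : R := \sum_i (x ord0 i - c ord0 i) ^+ 2.

Definition eball c (t : R) : set 'rV[R]_n := [set x | sqdist c x < t ^+ 2].

Lemma sqdist_ge0 c x : 0 <= sqdist c x.
Proof. by apply: sumr_ge0 => i _; exact: sqr_ge0. Qed.

Lemma eball0 c : eball c 0 = set0.
Proof. by apply/seteqP; split => // x; rewrite /eball/= expr0n/= ltNge sqdist_ge0. Qed.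

Lemma subset_eball c s t : 0 <= s -> s <= t -> eball c s `<=` eball c t.
Proof.
by move=> s0 st x /lt_le_trans; apply; rewrite ler_pXn2r// nnegrE// (le_trans s0).
Qed.

Lemma coord_le_sqdist c x i : (x ord0 i - c ord0 i) ^+ 2 <= sqdist c x.
Proof. by rewrite /sqdist (bigD1 i)//= lerDl; apply: sumr_ge0 => j _; exact: sqr_ge0. Qed.

Lemma measurable_sqdist c :
  measurable_fun setT (fun x : caratheodory_type (leb_outer R n) => sqdist c x).
Proof.
apply: measurable_sum => i; apply: measurable_funX; apply: measurable_funB => //.
exact: measurable_fun_coord.
Qed.

Lemma measurable_eball c t : leb_measurable (eball c t).
Proof.
have := measurable_sqdist c measurableT _ (measurable_itv `]-oo, t ^+ 2[).
rewrite setTI; congr (measurable _); apply/seteqP; split => x /=; by rewrite in_itv/=.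
Qed.

(** The homothety of ratio s / t fixing [c] maps the ball of radius t into the ball of radius s. *)
Lemma leb_eball_scale c s t : 0 < s -> 0 < t ->
  (leb R n (eball c t) <= ((t / s) ^+ n)%:E * leb R n (eball c s))%E.
Proof.
move=> s0 t0; have ts0 : 0 < s / t by rewrite divr_gt0.
have -> : t / s = (s / t)^-1 by rewrite invf_div.
apply: le_trans (leb_outer_homothety (s / t) ((1 - s / t) *: c) (eball c s) ts0).
apply: le_leb_outer => x; rewrite /eball/= => xt.
rewrite (_ : sqdist _ _ = (s / t) ^+ 2 * sqdist c x).
  by rewrite exprMn exprVn mulrAC ltr_pdivrMr ?exprn_gt0// ltr_pM2l ?exprn_gt0.
rewrite /sqdist mulr_sumr; apply: eq_bigr => i _; rewrite !mxE; ring.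
Qed.

Lemma leb_eball_lty c t : (leb R n (eball c t) < +oo)%E.
Proof.
rewrite /leb.
pose q : 'rV[R]_n * 'rV[R]_n := (c - const_mx (`|t| + 1), c + const_mx (`|t| + 1)).
apply: (@le_lt_trans _ _ (box_vol q)%:E); last by rewrite ltry.
pose Q k : option ('rV[R]_n * 'rV[R]_n) := if k == 0%N then Some q else None.
have -> : (box_vol q)%:E = (\sum_(0 <= k <oo) (obox_vol (Q k))%:E)%E.
  rewrite (@nneseries_split _ _ 0 1)/=; last by move=> *; exact: obox_vol_ge0.
  rewrite big_nat1/= eseries0 ?adde0// => -[]//.
apply: ereal_inf_lbound; exists Q => //.
move=> x xt; exists 0%N => //= i; rewrite !mxE.
have h : (x ord0 i - c ord0 i) ^+ 2 < `|t| ^+ 2.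
  by rewrite real_normK ?num_real//; exact: le_lt_trans (coord_le_sqdist c x i) xt.
have {}h : `|x ord0 i - c ord0 i| < `|t|.
  by rewrite -(ltr_pXn2r (_ : 0 < 2)%N) ?nnegrE//= real_normK ?num_real.
by move: h; rewrite ltr_norml => /andP[]; lra.
Qed.

End lebesgue_measure_rV.

(** * Coverings by rational balls and thin spherical shells *)

Section balls.
Context {R : realType} {n : nat}.
Implicit Types (x c : 'rV[R]_n) (A B : set 'rV[R]_n).

Lemma sub_eball_coord c t x : 0 <= t -> eball c t x ->
  forall i, `|x ord0 i - c ord0 i| < t.
Proof.
move=> t0 xt i; rewrite -(@ltr_pXn2r _ 2)// ?nnegrE// real_normK ?num_real//.
exact: le_lt_trans (coord_le_sqdist c x i) xt.
Qed.

(** The factor n + 1 is a crude substitute for sqrt n; it also makes the inequality strict. *)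
Lemma eball_coord_sub c t x : (forall i, `|x ord0 i - c ord0 i| <= t) -> 0 < t ->
  eball c (n.+1%:R * t) x.
Proof.
move=> xt t0; rewrite /eball/=.
apply: (@le_lt_trans _ _ (\sum_(i < n) t ^+ 2)).
  apply: ler_sum => i _; rewrite -real_normK ?num_real//.
  by rewrite ler_pXn2r// nnegrE// ltW.
rewrite sumr_const card_ord exprMn -[_ *+ n]mulr_natl ltr_pM2r ?exprn_gt0//.
by rewrite -natrX ltr_nat -[ltnLHS]expn1 (@leq_trans (n.+1 ^ 1))// leq_pexp2l.
Qed.

Lemma open_eball_cover (G : set 'rV[R]_n) : open G ->
  exists (c : nat -> 'rV[R]_n) (r : nat -> R),
    [/\ forall k, 0 <= r k, forall k, eball (c k) (r k) `<=` G &
        G `<=` \bigcup_k eball (c k) (r k)].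
Proof.
move=> oG.
pose good (p : 'rV[rat]_n * rat) :=
  `[< 0 <= (ratr p.2 : R) /\ eball (map_mx ratr p.1) (ratr p.2 : R) `<=` G >].
(* Codes that do not give a rational ball inside [G] are sent to radius 0, that is, to the empty
   ball. *)
pose f k : 'rV[R]_n * R := match unpickle k with
  | Some p => if good p then (map_mx ratr p.1, ratr p.2) else (0, 0)
  | None => (0, 0) end.
exists (fun k => (f k).1), (fun k => (f k).2).
have P k : 0 <= (f k).2 /\ eball (f k).1 (f k).2 `<=` G.
  rewrite /f; case: (unpickle k) => [p|]/=; last by rewrite eball0; split.
  by case: ifPn => [/asboolP|_] /=; [|rewrite eball0; split].
split; [by move=> k; have [] := P k|by move=> k; have [] := P k|].
move=> x Gx; have /nbhs_ballP[e /= e0 eG] := open_nbhs_nbhs (conj oG Gx).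
have e42 : e / 4 < e / 2 by lra.
have [q] := rat_in_itvoo e42.
rewrite in_itv/= => /andP[q1 q2].
have q0 : (0 : R) < ratr q by apply: lt_trans q1; lra.
(* With this choice (n + 1) h < q: a ball of radius q whose centre is within h of [x] in each
   coordinate contains [x], and q < e / 2 keeps it inside the sup-norm ball of radius e about
   [x]. *)
set h : R := ratr q / n.+2%:R.
have h0 : 0 < h by rewrite divr_gt0.
have hq : n.+1%:R * h < ratr q.
  by rewrite /h mulrCA gtr_pMr// ltr_pdivrMr// mul1r ltr_nat.
have hq' : h <= ratr q.
  by rewrite /h ler_pdivrMr// ler_peMr ?ler1n// ltW.
have xa i : {a : rat | ratr a \in `]x ord0 i - h, x ord0 i + h[}.
  apply: cid; have [a aP] := @rat_in_itvoo R (x ord0 i - h) (x ord0 i + h) ltac:(lra).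
  by exists a.
pose a : 'rV[rat]_n := \row_i sval (xa i).
have aP i : `|x ord0 i - (map_mx ratr a : 'rV[R]_n) ord0 i| <= h.
  rewrite !mxE; have := svalP (xa i); rewrite in_itv/= ler_norml; lra.
have ga : good (a, q).
  apply/asboolP; split; first exact: ltW.
  move=> y /= /(sub_eball_coord _ _ _ (ltW q0)) ya; apply: eG; split=> [|i j]; first exact: e0.
  rewrite [i]ord1; have := ya j; have := aP j; rewrite /ball/=.
  move: (map_mx _ _ _ _) => u; rewrite ltr_norml ler_norml ltr_norml; lra.
exists (pickle (a, q)) => //; rewrite /f pickleK ga/=.
apply: subset_eball (eball_coord_sub _ _ _ aP h0); last exact: ltW.
by rewrite mulr_ge0// ltW.
Qed.

Lemma open_leb_measurable (G : set 'rV[R]_n) : open G -> leb_measurable G.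
Proof.
move=> /open_eball_cover[c [r [r0 rG Gr]]].
rewrite (_ : G = \bigcup_k eball (c k) (r k)).
  by apply: bigcup_measurable => k _; exact: measurable_eball.
by apply/seteqP; split => // x [k _]; exact: rG.
Qed.

Lemma continuous_leb_measurable (f : 'rV[R]_n -> R) : continuous f ->
  measurable_fun setT (f : caratheodory_type (leb_outer R n) -> R).
Proof.
move=> /continuousP cf; apply: (measurability _ (RGenOpens.measurableE R)).
move=> _ [_ [a [b ->] <-]]; rewrite setTI.
exact/open_leb_measurable/cf/interval_open.
Qed.

(** Spheres are null, in quantitative form: by scaling, the shell has volume at most ((t + h) / (t -
    h))^n - 1 times that of the ball of radius 2 t, and this tends to 0 with h. *)
Lemma eball_volume_continuous c t d : 0 < t -> 0 < d ->
  exists2 h, 0 < h < t &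
    (leb R n (eball c (t + h) `\` eball c (t - h)) <= d%:E)%E.
Proof.
move=> t0 d0.
pose V := fine (leb R n (eball c (2 * t))).
have fV s : leb R n (eball c s) \is a fin_num.
  by rewrite ge0_fin_numE ?leb_outer_ge0// leb_eball_lty.
have cv : (((t + h) / (t - h)) ^+ n - 1) * V @[h --> 0^'+] --> 0.
  rewrite [X in _ --> X](_ : 0 = (((t + 0) / (t - 0)) ^+ n - 1) * V); last first.
    by rewrite addr0 subr0 divff ?gt_eqF// expr1n subrr mul0r.
  apply: cvg_at_right_filter.
  apply: cvgM; last exact: cvg_cst.
  apply: cvgB; last exact: cvg_cst.
  apply: (@cvg_comp _ _ _ (fun h => (t + h) / (t - h)) (fun y => y ^+ n));
    last exact: exprn_continuous.
  apply: cvgM; first by apply: cvgD; [exact: cvg_cst|exact: cvg_id].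
  apply: cvgV; first by rewrite subr0 gt_eqF.
  by apply: cvgB; [exact: cvg_cst|exact: cvg_id].
have H : \forall h \near 0^'+, (((t + h) / (t - h)) ^+ n - 1) * V < d.
  by move/cvgr_lt : cv; apply.
near ((0 : R)^'+) => h.
have h0 : 0 < h by near: h; exact: nbhs_right_gt.
have ht : h < t by near: h; exact: nbhs_right_lt.
exists h; first by rewrite h0 ht.
have hd : (((t + h) / (t - h)) ^+ n - 1) * V < d by near: h.
rewrite measureD; [|exact: measurable_eball|exact: measurable_eball|exact: leb_eball_lty].
rewrite setIidr; last by apply: subset_eball; lra.
have := @leb_eball_scale R n c (t - h) (t + h) ltac:(lra) ltac:(lra).
have : (leb R n (eball c (t - h)) <= leb R n (eball c (2 * t)))%E.
  apply: le_measure; rewrite ?inE; [exact: measurable_eball|exact: measurable_eball|].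
  by apply: subset_eball; lra.
rewrite -[X in _ -> _ -> (X - _ <= _)%E](fineK (fV _)).
rewrite -[X in _ -> _ -> (_ - X <= _)%E](fineK (fV _)).
rewrite -(fineK (fV (t - h))) -(fineK (fV (t + h))) -(fineK (fV (2 * t))).
rewrite -EFinM -EFinB !lee_fin -/V => h1 h2.
set k := ((t + h) / (t - h)) ^+ n in hd h2.
have k1 : 1 <= k.
  by rewrite exprn_ege1// ler_pdivlMr ?mul1r; lra.
nra.
Unshelve. all: by end_near. Qed.

End balls.

(** * A C^1 transition function *)

Section step_function.
Context {R : realType}.
Implicit Types (u h a e : R).

(** A quadratic bound on the Taylor remainder identifies the derivative; it treats squares of
    positive parts uniformly, including at their kinks. *)
Lemma is_derive_quadratic_remainder (f : R -> R) u (d C : R) :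
  (forall h, `|f (h + u) - f u - d * h| <= C * h ^+ 2) -> is_derive u 1 f d.
Proof.
move=> H.
have cv : h^-1 *: (f (h *: (1 : R) + u) - f u) @[h --> 0^'] --> d.
  apply/cvgrPdist_le => e e0.
  have C0 : 0 <= C.
    by have := le_trans (normr_ge0 _) (H 1); rewrite expr1n mulr1.
  near=> h.
  have h0 : h != 0 by near: h; exact: nbhs_dnbhs_neq.
  have he : `|h| < e / (C + 1).
    by near: h; apply: dnbhs0_lt; rewrite divr_gt0// ltr_wpDl.
  have -> : d - h^-1 *: (f (h *: (1 : R) + u) - f u) =
            - (h^-1 * (f (h + u) - f u - d * h)).
    by rewrite /GRing.scale/= mulr1; field.
  rewrite normrN normrM normfV ler_pdivrMl ?normr_gt0//.
  apply: (le_trans (H h)); rewrite -real_normK ?num_real// expr2 mulrCA.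
  rewrite ler_wpM2l//.
  move: he; rewrite ltr_pdivlMr ?ltr_wpDl// => he.
  by have := normr_ge0 h; nra.
by split; [apply/cvg_ex; exists d|exact: cvg_lim].
Unshelve. all: by end_near. Qed.

Let p u : R := Num.max 0 u ^+ 2.

Let p_remainder u h : `|p (h + u) - p u - 2 * Num.max 0 u * h| <= h ^+ 2.
Proof.
by rewrite /p /Num.max ler_norml; case: ifPn; rewrite -?leNgt; case: ifPn;
  rewrite -?leNgt; nra.
Qed.

(* Increases from 0 to 1 on [a, a + e]; its derivative is a piecewise linear tent,
   so it is exactly C^1. *)
Definition smoothstep a e u : R :=
  let v := (u - a) / e in
  2 * Num.max 0 v ^+ 2 - 4 * Num.max 0 (v - 2^-1) ^+ 2 + 2 * Num.max 0 (v - 1) ^+ 2.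

Definition dsmoothstep a e u : R :=
  let v := (u - a) / e in
  4 * (Num.max 0 v - 2 * Num.max 0 (v - 2^-1) + Num.max 0 (v - 1)) / e.

Lemma is_derive_smoothstep a e u : 0 < e ->
  is_derive u 1 (smoothstep a e) (dsmoothstep a e u).
Proof.
move=> e0; apply: (@is_derive_quadratic_remainder _ _ _ (8 / e ^+ 2)) => h.
rewrite /smoothstep /dsmoothstep -!/(p _) /=.
set v := (u - a) / e; set k := h / e.
have -> : (h + u - a) / e = k + v by rewrite /k /v; ring.
have -> : k + v - 2^-1 = k + (v - 2^-1) by ring.
have -> : k + v - 1 = k + (v - 1) by ring.
have -> : 8 / e ^+ 2 * h ^+ 2 = 8 * k ^+ 2 by rewrite /k; field; lra.
have := p_remainder v k; have := p_remainder (v - 2^-1) k.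
have := p_remainder (v - 1) k.
set x1 := Num.max 0 (v - 1); set x2 := Num.max 0 (v - 2^-1); set x3 := Num.max 0 v.
have -> : 4 * (x3 - 2 * x2 + x1) / e * h = 4 * (x3 - 2 * x2 + x1) * k.
  by rewrite /k; field; lra.
rewrite !ler_norml; lra.
Qed.

Lemma continuous_dsmoothstep a e : continuous (dsmoothstep a e).
Proof.
have cm (b : R) : continuous (fun u : R => Num.max 0 ((u - a) / e - b)).
  move=> u.
  apply: (@continuous_max _ _ (fun=> 0) (fun u : R => (u - a) / e - b)); first exact: cvg_cst.
  apply: cvgB; last exact: cvg_cst.
  by apply: cvgM; [apply: cvgB; [exact: cvg_id|exact: cvg_cst]|exact: cvg_cst].
move=> u; rewrite /dsmoothstep /=.
apply: cvgM; last exact: cvg_cst.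
apply: cvgM; first exact: cvg_cst.
apply: cvgD; last exact: cm.
apply: (@cvgB _ _ _ _ _ (fun u : R => Num.max 0 ((u - a) / e))); last first.
  by apply: cvgM; [exact: cvg_cst|exact: cm].
have c0 : continuous (fun u : R => Num.max 0 ((u - a) / e)).
  by have := cm 0; under eq_fun do rewrite subr0.
exact: c0.
Qed.

Lemma smoothstep_itv a e u : 0 <= smoothstep a e u <= 1.
Proof.
rewrite /smoothstep /=; move: ((u - a) / e) => v; rewrite /Num.max.
by repeat case: ifPn; rewrite -?leNgt; nra.
Qed.

Lemma smoothstep_le a e u : 0 < e -> u <= a -> smoothstep a e u = 0.
Proof.
move=> e0 ua; rewrite /smoothstep /=.
have : (u - a) / e <= 0 by rewrite ler_pdivrMr// mul0r subr_le0.
move: ((u - a) / e) => v v0; rewrite /Num.max.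
by repeat case: ifPn; rewrite -?leNgt; lra.
Qed.

Lemma smoothstep_ge a e u : 0 < e -> a + e <= u -> smoothstep a e u = 1.
Proof.
move=> e0 ua; rewrite /smoothstep /=.
have : 1 <= (u - a) / e by rewrite ler_pdivlMr// mul1r; lra.
move: ((u - a) / e) => v v0; rewrite /Num.max.
by repeat case: ifPn; rewrite -?leNgt; nra.
Qed.

Lemma dsmoothstep_itv a e u : 0 < e -> 0 <= dsmoothstep a e u <= 2 / e.
Proof.
move=> e0; rewrite /dsmoothstep /= divr_ge0 ?(ltW e0)//=.
  rewrite ler_pM2r ?invr_gt0//; move: ((u - a) / e) => v; rewrite /Num.max.
  by repeat case: ifPn; rewrite -?leNgt; lra.
move: ((u - a) / e) => v; rewrite /Num.max.
by repeat case: ifPn; rewrite -?leNgt; lra.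
Qed.

Lemma dsmoothstep_out a e u : 0 < e -> u <= a \/ a + e <= u -> dsmoothstep a e u = 0.
Proof.
move=> e0 h; rewrite /dsmoothstep /=.
suff -> : forall v : R, v <= 0 \/ 1 <= v ->
   Num.max 0 v - 2 * Num.max 0 (v - 2^-1) + Num.max 0 (v - 1) = 0.
- by rewrite mulr0 mul0r.
- case: h => h; [left|right].
    by rewrite ler_pdivrMr// mul0r subr_le0.
  by rewrite ler_pdivlMr// mul1r; lra.
- move=> v [] hv; rewrite /Num.max;
  by repeat case: ifPn; rewrite -?leNgt; lra.
Qed.

End step_function.

(** * C^1 vector fields *)

Section vector_fields.
Context {R : realType} {n : nat}.
Implicit Types (x c v : 'rV[R]_n) (phi : 'rV[R]_n -> 'rV[R]_n) (f : 'rV[R]_n -> R).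

Lemma continuous_sum (V : normedModType R) (F : 'I_n -> 'rV[R]_n -> V) :
  (forall i, continuous (F i)) -> continuous (fun x => \sum_i F i x).
Proof. by move=> cF; apply: continuous_big => //; exact: add_continuous. Qed.

Lemma continuous_mul f g : continuous f -> continuous g -> continuous (fun x => f x * g x).
Proof. by move=> cf cg x; exact: (@continuousM _ _ f g x (cf x) (cg x)). Qed.

Lemma continuous_add f g : continuous f -> continuous g -> continuous (fun x => f x + g x).
Proof. by move=> cf cg x; exact: (@continuousD _ _ _ f g x (cf x) (cg x)). Qed.

Lemma differentiable_cont f : (forall x, differentiable f x) -> continuous f.
Proof. by move=> df x; exact/differentiable_continuous. Qed.

Definition scalar_C1 f : Prop :=
  (forall x, differentiable f x) /\ (forall v, continuous (fun x => 'D_v f x)).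

Lemma is_derive_coord phi x v i : differentiable phi x ->
  is_derive x v (fun y => phi y ord0 i) ('D_v phi x ord0 i).
Proof.
move=> dphi; have dx : derivable phi x v by exact: diff_derivable.
split; first by move/derivable_mxP : dx; apply.
by rewrite derive_mx// mxE.
Qed.

Lemma row_sum_delta_fun phi :
  phi = (fun x => \sum_i phi x ord0 i *: (delta_mx ord0 i : 'rV[R]_n)).
Proof. by apply/funext => x; rewrite [LHS]row_sum_delta. Qed.

(** Conversely to taking coordinates, a field is the sum of its coordinates times the basis vectors,
    and both differentiability and continuity of the derivatives pass to this sum. *)
Lemma C1_coordP phi : C1 phi <-> forall i, scalar_C1 (fun x => phi x ord0 i).
Proof.
split=> [[dphi cphi] i|H].
  split=> [x|v].
    apply: (@differentiable_comp _ _ _ _ phi (fun M : 'rV[R]_n => M ord0 i)) => //.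
    exact: differentiable_coord.
  rewrite (_ : (fun x => _) = (fun x => 'D_v phi x ord0 i)); last first.
    by apply/funext => x; have [_ ->] := is_derive_coord _ x v i (dphi x).
  move=> x; apply: (@cvg_comp _ _ _ ('D_v phi) (fun M : 'rV[R]_n => M ord0 i) (nbhs x)
    _ _ (cphi v x)).
  exact: coord_continuous.
have dphi x : differentiable phi x.
  rewrite (row_sum_delta_fun phi).
  rewrite (_ : (fun x => _) = \sum_i (fun x => phi x ord0 i *: (delta_mx ord0 i : 'rV[R]_n))).
    by apply: differentiable_sum => i; apply: differentiableZl; exact: (H i).1.
  by apply/funext => y; rewrite fct_sumE.
split=> // v; rewrite (row_sum_delta_fun ('D_v phi)).
apply: continuous_sum => i x; apply: cvgZr_tmp; first exact: (nbhs_filter x).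
have ci : continuous (fun y => 'D_v phi y ord0 i).
  rewrite (_ : (fun y => _) = (fun y => 'D_v (fun z => phi z ord0 i) y)).
    exact: (H i).2.
  by apply/funext => y; have [_ ->] := is_derive_coord _ y v i (dphi y).
exact: (ci x).
Qed.

Lemma scalar_C1M f g : scalar_C1 f -> scalar_C1 g -> scalar_C1 (fun x => f x * g x).
Proof.
move=> [df cf] [dg cg]; split=> [x|v]; first exact: differentiableM.
rewrite (_ : (fun x => _) = (fun x => f x * 'D_v g x + g x * 'D_v f x)); last first.
  by apply/funext => x; rewrite (@deriveM _ _ f g)//; exact: diff_derivable.
by apply: continuous_add; apply: continuous_mul => //; exact: differentiable_cont.
Qed.

Lemma scalar_C1D f g : scalar_C1 f -> scalar_C1 g -> scalar_C1 (fun x => f x + g x).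
Proof.
move=> [df cf] [dg cg]; split=> [x|v]; first exact: differentiableD.
rewrite (_ : (fun x => _) = (fun x => 'D_v f x + 'D_v g x)); last first.
  by apply/funext => x; rewrite (@deriveD _ _ _ f g)//; exact: diff_derivable.
exact: continuous_add.
Qed.

Lemma is_derive_coordB c x v i :
  is_derive x v (fun y : 'rV[R]_n => y ord0 i - c ord0 i) (v ord0 i).
Proof.
have -> : v ord0 i = 'D_v id x ord0 i - 0 by rewrite derive_id subr0.
apply: is_deriveB; exact: is_derive_coord.
Qed.

Lemma scalar_C1_coordB c i : scalar_C1 (fun x => x ord0 i - c ord0 i).
Proof.
split=> [x|v]; first by apply: differentiableB => //; exact: differentiable_coord.
rewrite (_ : (fun x => _) = (fun=> v ord0 i)); first exact: cst_continuous.
by apply/funext => x; have [_ ->] := is_derive_coordB c x v i.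
Qed.

Lemma is_derive_sqdist c x v :
  is_derive x v (sqdist c) (2 * \sum_i (x ord0 i - c ord0 i) * v ord0 i).
Proof.
have -> : sqdist c = \sum_i (fun y : 'rV[R]_n => (y ord0 i - c ord0 i) * (y ord0 i - c ord0 i)).
  by apply/funext => y; rewrite fct_sumE; apply: eq_bigr => i _; rewrite expr2.
rewrite mulr_sumr; apply: is_derive_sum => i.
have dc := is_derive_coordB c x v i.
apply: is_derive_eq; rewrite /GRing.scale/=; ring.
Qed.

Lemma scalar_C1_sqdist c : scalar_C1 (sqdist c).
Proof.
split=> [x|v].
  have -> : sqdist c = \sum_i (fun y : 'rV[R]_n => (y ord0 i - c ord0 i) * (y ord0 i - c ord0 i)).
    by apply/funext => y; rewrite fct_sumE; apply: eq_bigr => i _; rewrite expr2.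
  apply: differentiable_sum => i; apply: differentiableM; exact: (scalar_C1_coordB c i).1.
rewrite (_ : (fun x => _) = (fun x => 2 * \sum_i (x ord0 i - c ord0 i) * v ord0 i)).
  apply: continuous_mul; first exact: cst_continuous.
  have cs := continuous_sum R^o (fun i y => (y ord0 i - c ord0 i) * v ord0 i).
  apply: cs => i; apply: continuous_mul; last exact: cst_continuous.
  exact/differentiable_cont/(scalar_C1_coordB c i).1.
by apply/funext => x; have [_ ->] := is_derive_sqdist c x v.
Qed.

(** Derivatives of [h] are requested only at u >= 0, where [sqdist] takes its values: the function
    [profile] used below has a pole at a negative argument. *)
Lemma is_derive_radial c x v (h dh : R -> R) :
  (forall u : R, 0 <= u -> is_derive u 1 h (dh u)) ->
  is_derive x v (fun y => h (sqdist c y))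
    (dh (sqdist c x) * (2 * \sum_i (x ord0 i - c ord0 i) * v ord0 i)).
Proof.
move=> hh; have [dq Dq] := is_derive_sqdist c x v.
have dqx := (scalar_C1_sqdist c).1 x.
have [dhx Dhx] := hh _ (sqdist_ge0 c x).
have dhq : differentiable h (sqdist c x) by exact/derivable1_diffP.
split; first by apply: diff_derivable; apply: differentiable_comp.
rewrite deriveE; last exact: differentiable_comp.
rewrite (diff_comp dqx dhq)/= -(deriveE v dqx) Dq deriv1E// derive1E Dhx.
by rewrite /GRing.scale/= mulrC.
Qed.

Lemma scalar_C1_radial c (h dh : R -> R) :
  (forall u : R, 0 <= u -> is_derive u 1 h (dh u)) ->
  (forall u : R, 0 <= u -> {for u, continuous dh}) ->
  scalar_C1 (fun x => h (sqdist c x)).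
Proof.
move=> hh ch; have [dq cq] := scalar_C1_sqdist c; split=> [x|v].
  apply: differentiable_comp => //; apply/derivable1_diffP.
  by have [] := hh _ (sqdist_ge0 c x).
rewrite (_ : (fun x => _) = (fun x => dh (sqdist c x) * 'D_v (sqdist c) x)); last first.
  apply/funext => x; have [_ ->] := is_derive_radial c x v h dh hh.
  by have [_ ->] := is_derive_sqdist c x v.
apply: continuous_mul => // x.
apply: (@cvg_comp _ _ _ (sqdist c) dh (nbhs x) (nbhs (sqdist c x))).
  exact/differentiable_continuous.
exact/ch/sqdist_ge0.
Qed.

End vector_fields.

(** * Fields combined with a radial direction *)

Section radial_fields.
Context {R : realType} {n : nat}.
Implicit Types (x c v : 'rV[R]_n) (phi : 'rV[R]_n -> 'rV[R]_n).

Definition dotp c phi x : R := \sum_i phi x ord0 i * (x ord0 i - c ord0 i).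

Lemma enorm_le1 v : (enorm v <= 1) = (\sum_i v ord0 i ^+ 2 <= 1).
Proof.
have s0 : 0 <= \sum_i v ord0 i ^+ 2 by apply: sumr_ge0 => i _; exact: sqr_ge0.
by rewrite /enorm -{1}sqrtr1 ler_sqrt.
Qed.

(* AM-GM instead of Cauchy-Schwarz: with t the radius of the sphere it is sharp
   there, and it avoids the square root in [enorm]. *)
Lemma dotp_le c phi x (t : R) : enorm (phi x) <= 1 -> 0 < t ->
  dotp c phi x <= (t ^+ 2 + sqdist c x) / (2 * t).
Proof.
rewrite enorm_le1 => h t0.
have -> : (t ^+ 2 + sqdist c x) / (2 * t) = t / 2 * 1 + (2 * t)^-1 * sqdist c x.
  by field; lra.
apply: (@le_trans _ _ (t / 2 * \sum_i phi x ord0 i ^+ 2 + (2 * t)^-1 * sqdist c x)).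
  rewrite /sqdist !mulr_sumr -big_split/=; apply: ler_sum => i _.
  move: (phi x ord0 i) (x ord0 i - c ord0 i) => a b.
  rewrite -subr_ge0 (_ : _ - _ = (2 * t)^-1 * (t * a - b) ^+ 2); last by field; lra.
  by rewrite mulr_ge0 ?sqr_ge0// invr_ge0; lra.
by rewrite lerD2r ler_pM2l ?divr_gt0.
Qed.

Lemma compact_support_bounded phi c : compact_support phi ->
  exists T : R, forall x, T <= sqdist c x -> phi x = 0.
Proof.
move=> /compact_bounded [M [_ MP]].
have {}MP x : phi x != 0 -> forall i, `|x ord0 i| <= `|M| + 1.
  move=> px i; have := MP (`|M| + 1) ltac:(by rewrite ltr_pwDr// ler_norm) x.
  move=> /(_ (@subset_closure _ [set x | phi x != 0] x px))/=; apply: le_trans.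
  by rewrite [leRHS]/Num.Def.normr/= mx_normrE; exact: (le_bigmax _ _ (ord0, i)).
(* On the support each coordinate of x - c is at most |M| + 1 + |c_i| in absolute value; the final +
   1 gives the strict inequality required by the contrapositive. *)
exists (\sum_i (`|M| + 2 + `|c ord0 i|) ^+ 2 + 1) => x; apply: contra_leP => /eqP px.
rewrite ltr_pwDr// /sqdist; apply: ler_sum => i _.
rewrite -real_normK ?num_real// ler_pXn2r ?nnegrE ?addr_ge0//.
have := MP x px i; have := ler_normB (x ord0 i) (c ord0 i); lra.
Qed.

Lemma closed_sqdist_le c (T : R) : closed [set x | sqdist c x <= T].
Proof.
have cq := differentiable_cont _ (@scalar_C1_sqdist R n c).1.
exact: (closed_comp (fun x _ => cq x) (@closed_le R T)).
Qed.

Lemma compact_sqdist_le c (T : R) : compact [set x | sqdist c x <= T].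
Proof.
apply: bounded_closed_compact; last exact: closed_sqdist_le.
exists (\sum_i (`|c ord0 i|) + `|T| + 1); split; first exact: num_real.
move=> M hM x /= xT; apply: le_trans (ltW hM).
rewrite [leLHS]/Num.Def.normr/= mx_normrE; apply: bigmax_le => [|[i j] _ /=].
  by rewrite !addr_ge0//; apply: sumr_ge0.
rewrite [i]ord1 {i} (bigD1 j)//=.
have h1 : 0 <= \sum_(i < n | i != j) `|c ord0 i| by exact: sumr_ge0.
have h2 := le_trans (coord_le_sqdist c x j) xT.
have h3 : `|x ord0 j - c ord0 j| <= `|T| + 1.
  rewrite -(@ler_pXn2r _ 2)// ?nnegrE ?addr_ge0// real_normK ?num_real//.
  by have := ler_norm T; have := normr_ge0 T; nra.
by have := ler_normD (x ord0 j - c ord0 j) (c ord0 j); rewrite subrK; lra.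
Qed.

Lemma bounded_compact_support phi c (T : R) :
  (forall x, T <= sqdist c x -> phi x = 0) -> compact_support phi.
Proof.
move=> H; apply: subclosed_compact (compact_sqdist_le c T) _.
  exact: closed_closure.
rewrite closureE => x /(_ [set x | sqdist c x <= T]); apply; split.
  exact: closed_sqdist_le.
by move=> y /=; apply: contraNT; rewrite -ltNge => /ltW/H ->.
Qed.

(** Common form of both gluings: [h] fades [phi] out while [s] switches on a multiple of the radial
    direction. *)
Definition radial_field c (h s : R -> R) phi x : 'rV[R]_n :=
  h (sqdist c x) *: phi x + s (sqdist c x) *: (x - c).

Section properties.
Variables (c : 'rV[R]_n) (h dh s ds : R -> R) (phi : 'rV[R]_n -> 'rV[R]_n).
Hypothesis hh : forall u : R, 0 <= u -> is_derive u 1 h (dh u).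
Hypothesis ch : forall u : R, 0 <= u -> {for u, continuous dh}.
Hypothesis hs : forall u : R, 0 <= u -> is_derive u 1 s (ds u).
Hypothesis cs : forall u : R, 0 <= u -> {for u, continuous ds}.
Hypothesis phiC1 : C1 phi.

Let radial_fieldE i : (fun x => radial_field c h s phi x ord0 i) =
  (fun x => h (sqdist c x) * phi x ord0 i + s (sqdist c x) * (x ord0 i - c ord0 i)).
Proof. by apply/funext => x; rewrite /radial_field !mxE. Qed.

Lemma C1_radial_field : C1 (radial_field c h s phi).
Proof.
apply/C1_coordP => i; rewrite radial_fieldE.
apply: scalar_C1D; apply: scalar_C1M.
- exact: scalar_C1_radial hh ch.
- exact: (C1_coordP _).1.
- exact: scalar_C1_radial hs cs.
- exact: scalar_C1_coordB.
Qed.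

(** Product rule, the gradient of [sqdist] being 2 (x - c). The term with [dh] is the one that
    becomes large in a thin transition. *)
Lemma divergence_radial_field x : divergence (radial_field c h s phi) x =
  h (sqdist c x) * divergence phi x + 2 * dh (sqdist c x) * dotp c phi x +
  (n%:R * s (sqdist c x) + 2 * ds (sqdist c x) * sqdist c x).
Proof.
rewrite /divergence.
have D i : 'D_(delta_mx ord0 i) (fun y => radial_field c h s phi y ord0 i) x =
  h (sqdist c x) * 'D_(delta_mx ord0 i) (fun y => phi y ord0 i) x +
  2 * dh (sqdist c x) * (phi x ord0 i * (x ord0 i - c ord0 i)) +
  (s (sqdist c x) + 2 * ds (sqdist c x) * (x ord0 i - c ord0 i) ^+ 2).
  have dq : \sum_j (x ord0 j - c ord0 j) * (delta_mx ord0 i : 'rV[R]_n) ord0 j =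
      x ord0 i - c ord0 i.
    rewrite (bigD1 i)//= !mxE !eqxx mulr1 big1 ?addr0// => j ji.
    by rewrite !mxE (negbTE ji) mulr0.
  rewrite radial_fieldE.
  have d1 := is_derive_radial c x (delta_mx ord0 i) h dh hh.
  have d2 := is_derive_radial c x (delta_mx ord0 i) s ds hs.
  have d3 := is_derive_coordB c x (delta_mx ord0 i) i.
  have d4 : is_derive x (delta_mx ord0 i) (fun y => phi y ord0 i)
              ('D_(delta_mx ord0 i) (fun y => phi y ord0 i) x).
    by apply/derivableP/diff_derivable; exact: ((C1_coordP _).1 phiC1 i).1.
  have d5 := is_deriveD (is_deriveM d1 d4) (is_deriveM d2 d3).
  have [_ e] := d5; rewrite [LHS]e dq !mxE !eqxx /GRing.scale/=; ring.
under eq_bigr do rewrite D.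
by rewrite !big_split/= -!mulr_sumr sumr_const card_ord -[_ *+ n]mulr_natl.

Qed.

End properties.

(** The last hypothesis says that the radial part has norm at most 1 - h, so the sum has norm at
    most h + (1 - h). In squared form this is the convexity bound (h a + d y)^2 <= h a^2 + d^2 y^2 /
    (1 - h), summed over the coordinates. *)
Lemma enorm_radial_field c h s phi x : let q := sqdist c x in
  enorm (phi x) <= 1 -> 0 <= h q <= 1 -> s q ^+ 2 * q <= (1 - h q) ^+ 2 ->
  enorm (radial_field c h s phi x) <= 1.
Proof.
move=> q; rewrite !enorm_le1 => p1 /andP[h0 h1] sh.
rewrite [leLHS](_ : _ = \sum_i (h q * phi x ord0 i + s q * (x ord0 i - c ord0 i)) ^+ 2); last first.
  by apply: eq_bigr => i _; rewrite /radial_field !mxE.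
(* For h = 1 the division by 1 - h is impossible, but then the radial part vanishes. *)
move: h1; rewrite le_eqVlt => /orP[/eqP h1|h1].
  rewrite (eq_bigr (fun i => phi x ord0 i ^+ 2))// => i _.
  rewrite h1 mul1r; suff -> : s q * (x ord0 i - c ord0 i) = 0 by rewrite addr0.
  apply/eqP; rewrite -sqrf_eq0 eq_le sqr_ge0 andbT.
  move: sh; rewrite h1 subrr expr0n/=; apply: le_trans.
  by rewrite exprMn ler_wpM2l ?sqr_ge0// coord_le_sqdist.
have h1' : 0 < 1 - h q by lra.
apply: (@le_trans _ _ (h q * (\sum_i phi x ord0 i ^+ 2) + (1 - h q)^-1 * (s q ^+ 2 * q))).
  rewrite [X in _ <= _ + _ * X](_ : _ = s q ^+ 2 * \sum_i (x ord0 i - c ord0 i) ^+ 2)//.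
  rewrite !mulr_sumr -big_split/=.
  apply: ler_sum => i _; move: (phi x ord0 i) (x ord0 i - c ord0 i) (h q) (s q) h0 h1 h1'.
  move=> a y b d b0 b1 b1'.
  rewrite -subr_ge0 (_ : _ - _ = b / (1 - b) * ((1 - b) * a - d * y) ^+ 2); last by field; lra.
  by rewrite mulr_ge0 ?sqr_ge0 ?divr_ge0// ltW.
have : (1 - h q)^-1 * (s q ^+ 2 * q) <= 1 - h q.
  by rewrite ler_pdivrMl// -expr2.
by nra.
Qed.

Lemma test_field_radial c (h dh s ds : R -> R) phi (T : R) :
  (forall u : R, 0 <= u -> is_derive u 1 h (dh u)) ->
  (forall u : R, 0 <= u -> {for u, continuous dh}) ->
  (forall u : R, 0 <= u -> is_derive u 1 s (ds u)) ->
  (forall u : R, 0 <= u -> {for u, continuous ds}) ->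
  (forall u, 0 <= u -> 0 <= h u <= 1) ->
  (forall u, 0 <= u -> s u ^+ 2 * u <= (1 - h u) ^+ 2) ->
  (forall u, T <= u -> s u = 0) ->
  test_field phi -> test_field (radial_field c h s phi).
Proof.
move=> hh ch hs cs h01 sh sT [C1phi suppphi phi1]; split.
- exact: C1_radial_field.
- have [T' T'P] := compact_support_bounded phi c suppphi.
  apply: (@bounded_compact_support _ c (Num.max T T')) => x.
  rewrite ge_max => /andP[xT xT'].
  by rewrite /radial_field T'P// sT// scaler0 scale0r addr0.
- by move=> x; apply: enorm_radial_field => //; [exact/h01/sqdist_ge0|exact/sh/sqdist_ge0].
Qed.

End radial_fields.

(** * Integration of divergences *)

Section integration.
Context {R : realType} {n : nat}.
Implicit Types (x c v : 'rV[R]_n) (phi : 'rV[R]_n -> 'rV[R]_n) (f : 'rV[R]_n -> R).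
Local Notation mu := (leb R n).

Lemma integrable_bounded_support f (K D : set 'rV[R]_n) (M : R) :
  measurable_fun setT (f : caratheodory_type (leb_outer R n) -> R) ->
  leb_measurable K -> (mu K < +oo)%E -> leb_measurable D ->
  (forall x, `|f x| <= M) -> (forall x, ~ K x -> f x = 0) ->
  mu.-integrable D (EFin \o f).
Proof.
move=> mf mK Kfin mD fM fK; apply: (integrableS measurableT) => //.
have -> : EFin \o f = (EFin \o f) \_ K.
  apply/funext => x; rewrite patchE; case: ifPn => //.
  by rewrite notin_setE => /fK /= ->.
apply/(integrable_mkcond _ mK).1.
apply: measurable_bounded_integrable => //; first exact: measurable_funS mf.
exists M; split; first exact: num_real.
by move=> y My x _; apply: le_trans (fM x) (ltW My).
Qed.

(** Enlarging the threshold by 1 puts [x] inside an open set on which [f] vanishes. *)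
Lemma derive_support f v (T : R) x : (forall y, T <= sqdist 0 y -> f y = 0) ->
  T + 1 <= sqdist 0 x -> 'D_v f x = 0.
Proof.
move=> fT xT; rewrite (@near_eq_derive _ _ _ _ (cst 0)) ?derive_cst//.
have oT : open [set y : 'rV[R]_n | T < sqdist 0 y].
  have cq := differentiable_cont _ (@scalar_C1_sqdist R n 0).1.
  exact: (open_comp (fun x _ => cq x) (@open_gt R T)).
have : nbhs x [set y : 'rV[R]_n | T < sqdist 0 y].
  by apply: open_nbhs_nbhs; split => //=; lra.
by apply: filterS => y /= /ltW/fT.
Qed.

Lemma continuous_bounded_support f (T : R) : continuous f ->
  (forall y, T <= sqdist 0 y -> f y = 0) -> exists M : R, forall x, `|f x| <= M.
Proof.
move=> cf fT.
have : compact (f @` [set x | sqdist 0 x <= T]).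
  by apply: continuous_compact; [exact: continuous_subspaceT|exact: compact_sqdist_le].
move=> /compact_bounded[M [_ MP]].
exists (`|M| + 1) => x; case: (leP (sqdist 0 x) T) => xT; last first.
  by rewrite (fT _ (ltW xT)) normr0 addr_ge0.
by apply: MP; [rewrite ltr_pwDr// ler_norm|exists x].
Qed.

(** Controls the support of a translated function; the difference of the two sides is a sum of
    squares. *)
Lemma sqdist0_shift x (w : 'rV[R]_n) : sqdist 0 x <= 2 * sqdist 0 (x + w) + 2 * sqdist 0 w.
Proof.
rewrite /sqdist !mulr_sumr -big_split/=; apply: ler_sum => i _.
rewrite !mxE !subr0; move: (x ord0 i) (w ord0 i) => a b.
rewrite -subr_ge0 (_ : _ - _ = (a + 2 * b) ^+ 2) ?sqr_ge0//; ring.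
Qed.

Lemma sqdist0Z (k : R) (w : 'rV[R]_n) : sqdist 0 (k *: w) = k ^+ 2 * sqdist 0 w.
Proof. by rewrite /sqdist mulr_sumr; apply: eq_bigr => i _; rewrite !mxE !subr0 exprMn. Qed.

Lemma eball_support (T : R) x : ~ eball 0 (`|T| + 1) x -> T <= sqdist 0 x.
Proof.
rewrite /eball/= => /negP; rewrite -leNgt; apply: le_trans.
by have := ler_norm T; have := normr_ge0 T; nra.
Qed.

Lemma integrable_continuous_support f (D : set 'rV[R]_n) (T : R) :
  continuous f -> (forall y, T <= sqdist 0 y -> f y = 0) -> leb_measurable D ->
  mu.-integrable D (EFin \o f).
Proof.
move=> cf fT mD; have [M fM] := continuous_bounded_support f T cf fT.
apply: (@integrable_bounded_support f (eball 0 (`|T| + 1)) D M) => //.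
- exact: continuous_leb_measurable.
- exact: measurable_eball.
- exact: leb_eball_lty.
- by move=> x /eball_support/fT.
Qed.

Lemma continuous_shift v : continuous (fun x : 'rV[R]_n => x + v).
Proof.
by move=> x; apply: (@continuousD _ _ _ id (fun=> v)); [exact: cvg_id|exact: cst_continuous].
Qed.

(** Change of variables along the translation, whose image measure is again Lebesgue measure. *)
Lemma integral_shift f v (T : R) : continuous f ->
  (forall y, T <= sqdist 0 y -> f y = 0) ->
  (\int[mu]_x (f (x + v)%R)%:E = \int[mu]_x (f x)%:E)%E.
Proof.
move=> cf fT.
pose sh : caratheodory_type (leb_outer R n) -> caratheodory_type (leb_outer R n) :=
  fun x : 'rV[R]_n => x + v.
have msh : measurable_fun setT sh.
  by move=> _ A mA; rewrite setTI; exact: measurable_shift.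
have csh : continuous (fun x => f (x + v)).
  move=> x; apply: (@continuous_comp _ _ _ (fun x => x + v) f); last exact: cf.
  exact: continuous_shift.
have sT x : 2 * T + 2 * sqdist 0 v <= sqdist 0 x -> f (x + v) = 0.
  by move=> h; apply: fT; have := sqdist0_shift x v; lra.
have mf : measurable_fun setT (EFin \o f : caratheodory_type (leb_outer R n) -> \bar R).
  exact/measurable_EFinP/continuous_leb_measurable.
have := @integral_pushforward _ _ _ _ R sh msh mu setT (EFin \o f) mf
  (integrable_continuous_support _ _ _ csh sT measurableT) measurableT.
rewrite preimage_setT => <-; apply: eq_measure_integral => A mA _.
exact: leb_outer_shift.
Qed.

(* The difference quotients have integral 0 by translation invariance, and they are
   dominated by the mean value theorem. *)
Lemma integral_derive0 f v (T : R) : scalar_C1 f ->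
  (forall y, T <= sqdist 0 y -> f y = 0) ->
  (\int[mu]_x ('D_v f x)%:E = 0)%E.
Proof.
move=> [df cDf] fT.
have cf := differentiable_cont f df.
have [M DM] := continuous_bounded_support ('D_v f) (T + 1) (cDf v)
  (fun x => derive_support f v T x fT).
(* A single threshold beyond which all translates of [f] by s v with 0 <= s <= 1 vanish, hence all
   difference quotients too. *)
pose T' := 2 * T + 2 * sqdist 0 v.
pose h k : R := k.+1%:R^-1.
have h0 k : 0 < h k by rewrite invr_gt0.
have h1 k : h k <= 1 by rewrite invf_le1// ler1n.
pose F k x : R := (h k)^-1 * (f (x + h k *: v) - f x).
have fT' (s : R) x : 0 <= s <= 1 -> T' <= sqdist 0 x -> f (x + s *: v) = 0.
  move=> /andP[s0 s1] xT; apply: fT; have := sqdist0_shift x (s *: v); rewrite sqdist0Z.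
  have : s ^+ 2 * sqdist 0 v <= sqdist 0 v by rewrite ler_piMl ?sqdist_ge0 ?exprn_ile1.
  move: xT; rewrite /T'; lra.
have cs (s : R) : continuous (fun x => f (x + s *: v)).
  move=> x; apply: (@continuous_comp _ _ _ (fun x => x + s *: v) f); last exact: cf.
  exact: continuous_shift.
have FT k x : T' <= sqdist 0 x -> F k x = 0.
  move=> xT; have := fT' 0 x; rewrite scale0r addr0 /F => -> //; last by rewrite lexx ler01.
  by rewrite fT' ?subrr ?mulr0// h1 ltW.
have cF k : continuous (F k).
  apply: continuous_mul; first exact: cst_continuous.
  apply: continuous_add; first exact: cs.
  by move=> x; apply: (@continuousN _ _ _ f x); exact: cf.
have FM k x : `|F k x| <= M.
  have [t _ ft] : exists2 t, t \in `[0, h k]%R &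
      f (x + h k *: v) - f (x + 0 *: v) = 'D_v f (x + t *: v) * (h k - 0).
    have dg (t : R) : is_derive t 1 (fun t : R => f (x + t *: v)) ('D_v f (x + t *: v)).
      have dvt : derivable f (x + t *: v) v by exact: diff_derivable.
      have [dv Dv] := derivableP dvt.
      have e : (fun s : R => s^-1 *: (f (x + (s *: (1 : R) + t) *: v) - f (x + t *: v))) =
               (fun s => s^-1 *: (f (s *: v + (x + t *: v)) - f (x + t *: v))).
        apply/funext => s; congr (_ *: (f _ - _)).
        by rewrite [s *: 1]mulr1 scalerDl addrCA.
      by split; rewrite /derivable /derive /= e.
    apply: (@MVT_segment R (fun t : R => f (x + t *: v)) (fun t => 'D_v f (x + t *: v))).
    - exact: ltW.
    - apply: continuous_subspaceT => t; apply: differentiable_continuous.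
      by apply/derivable1_diffP; have [] := dg t.
  move: ft; rewrite scale0r addr0 subr0 /F => ->.
  by rewrite mulrCA mulVf ?gt_eqF// mulr1.
have IF k : (\int[mu]_x (F k x)%:E = 0)%E.
  rewrite /F; under eq_integral do rewrite EFinM.
  rewrite integralZl//; last first.
    apply: (integrable_continuous_support (fun x => f (x + h k *: v) - f x) setT T') => //;
      last exact: measurableT.
      apply: continuous_add; first exact: cs.
      by move=> x; apply: (@continuousN _ _ _ f x); exact: cf.
    move=> x xT; have := FT k x xT; rewrite /F => /eqP.
    by rewrite mulf_eq0 invr_eq0 gt_eqF//= => /eqP.
  under eq_integral do rewrite EFinB.
  rewrite integralB_EFin//.
  - rewrite (integral_shift f (h k *: v) T)// subee ?mule0//.
    apply: integrable_fin_num => //.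
    exact: (integrable_continuous_support f setT T cf fT measurableT).
  - apply: (integrable_continuous_support (fun x => f (x + h k *: v)) setT T') => //;
      last exact: measurableT.
    by move=> x; apply: fT'; rewrite h1 ltW.
  - exact: (integrable_continuous_support f setT T cf fT measurableT).
pose K : set 'rV[R]_n := eball 0 (`|T'| + 1).
(* The dominating function: the bound on the derivative, restricted to a ball containing all
   supports. *)
pose g : 'rV[R]_n -> R := fun x => if x \in K then M else 0.
have M0 : 0 <= M by apply: le_trans (DM 0).
have gE : g = (fun=> M) \_ K by apply/funext => x; rewrite patchE.
have mg : measurable_fun setT (g : caratheodory_type (leb_outer R n) -> R).
  rewrite gE; apply/(measurable_restrict _ _ _).1 => //; exact: measurable_eball.
have ig : mu.-integrable setT (EFin \o g).
  apply: (@integrable_bounded_support g K setT M) => //.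
  - exact: measurable_eball.
  - exact: leb_eball_lty.
  - exact: measurableT.
  - by move=> x; rewrite /g; case: ifPn => _; rewrite ?normr0// ger0_norm.
  - by move=> x Kx; rewrite /g memNset.
(* The increments tend to 0 through nonzero values, as the limit defining the derivative demands. *)
have hd : h @ \oo --> (0 : R)^'.
  move=> A nA; have {}nA : \forall k \near \oo, h k != 0 -> A (h k).
    exact: (@cvg_harmonic R (fun t => t != 0 -> A t) nA).
  by apply: filterS nA => k; apply; exact: lt0r_neq0 (h0 k).
have FD x : F ^~ x @ \oo --> 'D_v f x.
  have dvx : derivable f x v by exact: diff_derivable.
  have [dv Dv] := derivableP dvx.
  have cv : (t^-1 *: (f (t *: v + x) - f x)) @[t --> 0^'] --> 'D_v f x by exact: dv.
  rewrite (_ : F ^~ x = (fun t => t^-1 *: (f (t *: v + x) - f x)) \o h).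
    exact: (cvg_comp _ _ hd cv).
  by apply/funext => k; rewrite /F/= [x + _]addrC.
pose mu' : {measure set (caratheodory_type (leb_outer R n)) -> \bar R} := mu.
have ae1 : {ae mu', forall x : caratheodory_type (leb_outer R n), setT x ->
    (fun k => (F k x)%:E) @ \oo --> ('D_v f x)%:E}.
  by apply: aeW => x _; apply: cvg_EFin (FD x); exact: nearW.
have ae2 : {ae mu', forall (x : caratheodory_type (leb_outer R n)) k, setT x ->
    (`|(F k x)%:E| <= (g x)%:E)%E}.
  apply: aeW => x k _; rewrite lee_fin /g; case: ifPn => [_|]; first exact: FM.
  by rewrite notin_setE => /eball_support/FT ->; rewrite normr0.
have mF k : measurable_fun setT (EFin \o F k : caratheodory_type (leb_outer R n) -> \bar R).
  exact/measurable_EFinP/continuous_leb_measurable.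
have mDf : measurable_fun setT (EFin \o 'D_v f : caratheodory_type (leb_outer R n) -> \bar R).
  exact/measurable_EFinP/continuous_leb_measurable.
have [_ _ H] := dominated_convergence measurableT mF mDf ae1 ig ae2.
have := cvg_unique _ H (_ : _ --> 0%E); apply => //.
rewrite (_ : [sequence _]_k = fun=> 0%E); first exact: cvg_cst.
by apply/funext => k /=; exact: IF.
Qed.

End integration.

(** * Divergence theorem for test fields and first properties of the perimeter *)

Section divergence_integral.
Context {R : realType} {n : nat}.
Implicit Types (x c v : 'rV[R]_n) (phi : 'rV[R]_n -> 'rV[R]_n) (D E : set 'rV[R]_n).
Local Notation mu := (leb R n).

(* [Rintegral] is 0 on divergent integrals, which do not occur for test fields. *)
Definition div_int E phi : R := \int[leb R n]_(x in E) divergence phi x.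

Lemma coord_support phi : compact_support phi ->
  exists T : R, forall i x, T <= sqdist 0 x -> phi x ord0 i = 0.
Proof.
move=> /(compact_support_bounded phi 0)[T TP]; exists T => i x /TP ->.
by rewrite mxE.
Qed.

Lemma continuous_divergence phi : C1 phi -> continuous (divergence phi).
Proof.
move=> /C1_coordP Cphi.
apply: (continuous_sum R^o (fun i => 'D_(delta_mx ord0 i) (fun y => phi y ord0 i))) => i.
exact: (Cphi i).2.
Qed.

Lemma divergence_support phi : compact_support phi ->
  exists T : R, forall x, T <= sqdist 0 x -> divergence phi x = 0.
Proof.
move=> /coord_support[T TP]; exists (T + 1) => x xT.
by rewrite /divergence big1// => i _; exact: derive_support (TP i) xT.
Qed.

Lemma divergence_bounded phi : test_field phi ->
  exists M : R, forall x, `|divergence phi x| <= M.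
Proof.
move=> [Cphi /divergence_support[T TP] _].
exact: continuous_bounded_support (continuous_divergence _ Cphi) TP.
Qed.

Lemma integrable_divergence phi D : test_field phi -> leb_measurable D ->
  mu.-integrable D (EFin \o divergence phi).
Proof.
move=> [Cphi /divergence_support[T TP] _].
exact: integrable_continuous_support (continuous_divergence _ Cphi) TP.
Qed.

Lemma EFin_div_int phi D : test_field phi -> leb_measurable D ->
  (div_int D phi)%:E = (\int[leb R n]_(x in D) (divergence phi x)%:E)%E.
Proof.
by move=> tphi mD; rewrite fineK//; apply: integrable_fin_num => //; exact: integrable_divergence.
Qed.

Lemma le_Per phi E : test_field phi -> leb_measurable E -> ((div_int E phi)%:E <= Per E)%E.
Proof.
by move=> tphi mE; rewrite EFin_div_int//; apply: ereal_sup_ubound; exists phi.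
Qed.

Lemma Per_le E (y : \bar R) : leb_measurable E ->
  (forall phi, test_field phi -> ((div_int E phi)%:E <= y)%E) -> (Per E <= y)%E.
Proof.
by move=> mE H; apply: ge_ereal_sup => _ [phi tphi <-]; rewrite -EFin_div_int//; exact: H.
Qed.

Lemma div_intU phi D E : test_field phi -> leb_measurable D -> leb_measurable E ->
  D `&` E = set0 -> div_int (D `|` E) phi = div_int D phi + div_int E phi.
Proof.
move=> tphi mD mE DE; rewrite /div_int (@Rintegral_setU _ _ _ (leb R n))//.
  by apply: integrable_divergence => //; exact: measurableU.
by rewrite disj_set2E; apply/eqP.
Qed.

(** Each summand of the divergence is a partial derivative of a compactly supported function. *)
Lemma div_int_setT phi : test_field phi -> div_int setT phi = 0.
Proof.
move=> tphi; have [Cphi /coord_support[T TP] _] := tphi.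
apply: EFin_inj; rewrite EFin_div_int//; last exact: measurableT.
rewrite /divergence; under eq_integral do rewrite -sumEFin.
have Cphi' i := (C1_coordP phi).1 Cphi i.
rewrite (@integral_sum _ (caratheodory_type (leb_outer R n)) _ (leb R n) setT)//.
  by rewrite big1// => i _; exact: integral_derive0 (Cphi' i) (TP i).
move=> i; apply: (@integrable_continuous_support _ _
  ('D_(delta_mx ord0 i) (fun y => phi y ord0 i)) setT (T + 1)).
- exact: (Cphi' i).2.
- by move=> x; exact: derive_support (TP i).
- exact: measurableT.
Qed.

(** Meaningful even when a set or its complement has infinite measure, since the divergence has
    compact support. *)
Lemma div_int_setC phi E : test_field phi -> leb_measurable E ->
  div_int (~` E) phi = - div_int E phi.
Proof.
move=> tphi mE; have mCE : leb_measurable (~` E) by exact: measurableC.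
have := div_intU phi E (~` E) tphi mE mCE (setICr E).
by rewrite setUv div_int_setT// => /eqP; rewrite eq_sym addrC addr_eq0 => /eqP.
Qed.

Lemma div_int_le_cst phi D (a : R) : test_field phi -> leb_measurable D ->
  (mu D < +oo)%E -> (forall x, D x -> divergence phi x <= a) ->
  div_int D phi <= a * fine (mu D).
Proof.
move=> tphi mD Dfin H.
rewrite -(@Rintegral_cst _ (caratheodory_type (leb_outer R n)) R (leb R n))//.
apply: le_Rintegral => //; first exact: integrable_divergence.
apply: measurable_bounded_integrable => //.
exists `|a|; split; first exact: num_real.
by move=> y ay x _ /=; exact: ltW.
Qed.

Lemma div_int_ge_cst phi D (a : R) : test_field phi -> leb_measurable D ->
  (mu D < +oo)%E -> (forall x, D x -> a <= divergence phi x) ->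
  a * fine (mu D) <= div_int D phi.
Proof.
move=> tphi mD Dfin H.
rewrite -(@Rintegral_cst _ (caratheodory_type (leb_outer R n)) R (leb R n))//.
apply: le_Rintegral => //; last exact: integrable_divergence.
apply: measurable_bounded_integrable => //.
exists `|a|; split; first exact: num_real.
by move=> y ay x _ /=; exact: ltW.
Qed.

Lemma eq_div_int phi psi D : (forall x, D x -> divergence phi x = divergence psi x) ->
  div_int D phi = div_int D psi.
Proof. by move=> H; apply: eq_Rintegral => x /set_mem/H. Qed.

Lemma test_field0 : test_field (fun=> 0 : 'rV[R]_n).
Proof.
split.
- by split=> [x|v]; [exact: differentiable_cst|rewrite (_ : 'D_v _ = cst 0);
    [exact: cst_continuous|apply/funext => x; exact: derive_cst]].
- exact: (@bounded_compact_support _ _ _ 0 0).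
- by move=> x; rewrite enorm_le1 big1// => i _; rewrite mxE expr0n.
Qed.

Lemma divergence0 x : divergence (fun=> 0 : 'rV[R]_n) x = 0.
Proof.
rewrite /divergence big1// => i _; rewrite (_ : (fun=> _) = cst 0) ?derive_cst//.
by apply/funext => y; rewrite mxE.
Qed.

Lemma Per_ge0 E : leb_measurable E -> (0 <= Per E)%E.
Proof.
move=> mE; apply: le_trans (le_Per _ _ test_field0 mE).
rewrite EFin_div_int//; last exact: test_field0.
by rewrite integral0_eq// => x _; rewrite divergence0.
Qed.

Lemma Per0 : Per (set0 : set 'rV[R]_n) = 0%E.
Proof.
apply/eqP; rewrite eq_le Per_ge0 ?andbT; last exact: measurable0.
apply: Per_le; first exact: measurable0.
by move=> phi _; rewrite /div_int Rintegral_set0.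
Qed.

End divergence_integral.

(** * Gluing fields along a sphere *)

Section profile.
Context {R : realType}.
Implicit Types (t u : R).

Lemma is_deriveM_fun (f g : R -> R) u (a b : R) : is_derive u 1 f a -> is_derive u 1 g b ->
  is_derive u 1 (fun x => f x * g x) (a * g u + f u * b).
Proof.
move=> df dg; apply: (@is_derive_eq _ _ _ (f * g) _ _ _ _ (is_deriveM df dg)).
by rewrite /GRing.scale/= addrC [g u * a]mulrC.
Qed.

Lemma is_derive_1B (f : R -> R) u (a : R) : is_derive u 1 f a ->
  is_derive u 1 (fun x => 1 - f x) (- a).
Proof.
move=> df; have h := is_deriveB (is_derive_cst (1 : R) u 1) df.
by apply: (@is_derive_eq _ _ _ (cst (1 : R) - f) _ _ _ _ h); rewrite sub0r.
Qed.

(* x |-> profile t |x|^2 *: x is the field W of the header; profile t is tangent to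
   u |-> 1 / sqrt u at u = t^2 and lies below it. *)
Definition profile t u : R := 2 * t / (u + t ^+ 2).
Definition dprofile t u : R := - (2 * t) / (u + t ^+ 2) ^+ 2.

Lemma is_derive_profile t u : 0 < t -> 0 <= u ->
  is_derive u 1 (profile t) (dprofile t u).
Proof.
move=> t0 u0; have ut : u + t ^+ 2 != 0 by rewrite gt_eqF// ltr_wpDl// exprn_gt0.
have [d D] : is_derive u 1 (fun u : R => u + t ^+ 2) 1.
  have h := is_deriveD (is_derive_id u (1 : R)) (is_derive_cst (t ^+ 2) u 1).
  by apply: (@is_derive_eq _ _ _ (id + cst (t ^+ 2)) _ _ _ _ h); rewrite addr0.
have dV : is_derive u 1 (fun u : R => (u + t ^+ 2)^-1) (- (u + t ^+ 2) ^- 2).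
  split; first exact: derivableV.
  by rewrite deriveV// D /GRing.scale/= mulr1.
have := is_deriveM_fun (cst (2 * t)) _ _ _ _ (is_derive_cst (2 * t) u 1) dV.
by rewrite mul0r add0r /dprofile mulrN mulNr.
Qed.

Lemma continuous_dprofile t u : 0 < t -> 0 <= u -> {for u, continuous (dprofile t)}.
Proof.
move=> t0 u0; have ut : (u + t ^+ 2) ^+ 2 != 0.
  by rewrite expf_neq0// gt_eqF// ltr_wpDl// exprn_gt0.
apply: (@continuousM _ _ (fun=> - (2 * t)) (fun u => ((u + t ^+ 2) ^+ 2)^-1)).
  exact: cst_continuous.
apply: (@continuousV _ _ (fun u => (u + t ^+ 2) ^+ 2)) => //.
apply: (@continuous_comp _ _ _ (fun u => u + t ^+ 2) (fun y => y ^+ 2)); last first.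
  exact: exprn_continuous.
by apply: (@continuousD _ _ _ id (fun=> t ^+ 2)); [exact: cvg_id|exact: cst_continuous].
Qed.

Section bounds.
Variables (t u : R).
Hypotheses (t0 : 0 < t) (u0 : 0 <= u).

Let ut : 0 < u + t ^+ 2. Proof. by rewrite ltr_wpDl// exprn_gt0. Qed.

Lemma profile_ge0 : 0 <= profile t u.
Proof. by rewrite /profile divr_ge0 ?mulr_ge0// ltW. Qed.

Lemma profile_le : profile t u <= 2 / t.
Proof.
rewrite /profile ler_pdivrMr// mulrAC ler_pdivlMr// -mulrA -expr2.
by rewrite ler_pM2l// lerDr.
Qed.

Lemma dprofile_le0 : dprofile t u <= 0.
Proof. by rewrite /dprofile mulNr oppr_le0 divr_ge0 ?sqr_ge0// mulr_ge0// ltW. Qed.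

(** This is |W| <= 1; the defect is proportional to (u - t^2)^2 and vanishes exactly on the
    sphere. *)
Lemma profile_sqr_le1 : profile t u ^+ 2 * u <= 1.
Proof.
rewrite /profile expr_div_n mulrAC ler_pdivrMr ?exprn_gt0// mul1r.
rewrite -subr_ge0 (_ : _ - _ = (u - t ^+ 2) ^+ 2) ?sqr_ge0//; ring.
Qed.

Lemma profileM_le : profile t u * u <= 2 * t.
Proof.
rewrite /profile mulrAC ler_pdivrMr// ler_pM2l ?mulr_gt0// lerDl; exact: sqr_ge0.
Qed.

(* With u = |x|^2 and d = phi(x) . x, where |phi| <= 1: the loss in a transition of
   width e in |x|^2 is quadratic in e, hence negligible against its slope 1 / e. *)
Lemma profile_defect (e d : R) : d <= (t ^+ 2 + u) / (2 * t) ->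
  t ^+ 2 <= u <= t ^+ 2 + e -> d - profile t u * u <= e ^+ 2 / (4 * t ^+ 3).
Proof.
move=> hd /andP[h1 h2].
apply: (@le_trans _ _ ((t ^+ 2 + u) / (2 * t) - profile t u * u)).
  by rewrite lerD2r.
have -> : (t ^+ 2 + u) / (2 * t) - profile t u * u =
    (u - t ^+ 2) ^+ 2 / (2 * t * (u + t ^+ 2)).
  by rewrite /profile; field; rewrite !gt_eqF.
have -> : 4 * t ^+ 3 = 2 * t * (2 * t ^+ 2) by ring.
apply: ler_pM; rewrite ?sqr_ge0 ?invr_ge0//.
- by rewrite !mulr_ge0// ltW.
- by rewrite ler_pXn2r ?nnegrE//; lra.
- rewrite lef_pV2 ?posrE ?mulr_gt0 ?exprn_gt0//.
  by rewrite ler_pM2l ?mulr_gt0//; lra.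
Qed.

(** For k = n the right-hand side is div W at squared distance u. With k = 2 it equals 4 t^3 / (u +
    t^2)^2, which is where dimension at least 2 enters. *)
Lemma div_profile_ge (k rho : R) : 2 <= k -> t <= rho -> u <= rho ^+ 2 ->
  t ^+ 3 / rho ^+ 4 <= k * profile t u + 2 * dprofile t u * u.
Proof.
move=> k2 trho urho; have rho0 : 0 < rho by exact: lt_le_trans trho.
apply: (@le_trans _ _ (2 * profile t u + 2 * dprofile t u * u)); last first.
  by rewrite lerD2r ler_wpM2r ?profile_ge0.
have -> : 2 * profile t u + 2 * dprofile t u * u = 4 * t ^+ 3 / (u + t ^+ 2) ^+ 2.
  by rewrite /profile /dprofile; field; rewrite gt_eqF.
rewrite ler_pdivrMr ?exprn_gt0// mulrAC ler_pdivlMr ?exprn_gt0//.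
have h : (u + t ^+ 2) ^+ 2 <= 4 * rho ^+ 4.
  have -> : 4 * rho ^+ 4 = (2 * rho ^+ 2) ^+ 2 by ring.
  rewrite ler_pXn2r ?nnegrE//; [|exact: ltW|by rewrite mulr_ge0 ?sqr_ge0].
  have : t ^+ 2 <= rho ^+ 2 by rewrite ler_pXn2r// nnegrE ltW.
  lra.
have t30 : 0 < t ^+ 3 by exact: exprn_gt0.
by nra.
Qed.

Lemma div_profile_ge0 (k : R) : 2 <= k -> 0 <= k * profile t u + 2 * dprofile t u * u.
Proof.
move=> k2.
have h1 : t <= t + u + 1 by move: u0; lra.
have h2 : u <= (t + u + 1) ^+ 2 by move: u0 t0; nra.
apply: le_trans (div_profile_ge _ _ k2 h1 h2).
by rewrite divr_ge0 ?exprn_ge0// ?(ltW t0)// (le_trans (ltW t0)).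
Qed.

End bounds.
End profile.

(** * The glued fields and bounds on their divergence *)

Section cut_and_fill_fields.
Context {R : realType} {n : nat}.
Implicit Types (x c v : 'rV[R]_n) (phi psi : 'rV[R]_n -> 'rV[R]_n).

Lemma is_derive_continuous (f : R -> R) (u a : R) : is_derive u 1 f a ->
  {for u, continuous f}.
Proof. by move=> [d _]; apply/differentiable_continuous/derivable1_diffP. Qed.

Lemma continuousM_at (f g : R -> R) (u : R) : {for u, continuous f} ->
  {for u, continuous g} -> {for u, continuous (fun y => f y * g y)}.
Proof. exact: continuousM. Qed.

Lemma continuousD_at (f g : R -> R) (u : R) : {for u, continuous f} ->
  {for u, continuous g} -> {for u, continuous (fun y => f y + g y)}.
Proof. exact: continuousD. Qed.

Lemma continuousN_at (f : R -> R) (u : R) : {for u, continuous f} ->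
  {for u, continuous (fun y => - f y)}.
Proof. exact: continuousN. Qed.

(** The field is W inside the ball, [phi] beyond the shell, and an interpolation within it. There
    the slope of the interpolation, at most 2 / e, multiplies phi . (x - c) - W . (x - c), which is
    at most of order e^2 by [profile_defect]; the contribution is therefore of order e. *)
Lemma fill_field c t e phi : 0 < t -> 0 < e -> test_field phi ->
  exists2 psi, test_field psi &
    [/\ forall x, sqdist c x <= t ^+ 2 -> divergence psi x <= 2 * n%:R / t,
        forall x, t ^+ 2 <= sqdist c x <= t ^+ 2 + e ->
          divergence psi x <= `|divergence phi x| + e / t ^+ 3 + 2 * n%:R / t &
        forall x, t ^+ 2 + e <= sqdist c x -> divergence psi x = divergence phi x].
Proof.
move=> t0 e0 tphi.
pose h := smoothstep (t ^+ 2) e; pose dh := dsmoothstep (t ^+ 2) e.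
pose s u := (1 - h u) * profile t u.
pose ds u := - dh u * profile t u + (1 - h u) * dprofile t u.
have hh (u : R) : 0 <= u -> is_derive u 1 h (dh u) by move=> _; exact: is_derive_smoothstep.
have ch (u : R) : 0 <= u -> {for u, continuous dh} by move=> _; exact: continuous_dsmoothstep.
have hs (u : R) : 0 <= u -> is_derive u 1 s (ds u).
  by move=> u0; apply: is_deriveM_fun; [exact/is_derive_1B/hh|exact: is_derive_profile].
have cs (u : R) : 0 <= u -> {for u, continuous ds}.
  move=> u0; apply: continuousD_at; apply: continuousM_at.
  - exact/continuousN_at/ch.
  - exact: is_derive_continuous (is_derive_profile _ _ t0 u0).
  - exact: is_derive_continuous (is_derive_1B _ _ _ (hh u u0)).
  - exact: continuous_dprofile.
have h01 u : 0 <= h u <= 1 by exact: smoothstep_itv.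
have tpsi : test_field (radial_field c h s phi).
  apply: (test_field_radial c h dh s ds phi (t ^+ 2 + e)) => // [u u0|u ut].
  - have p1 := profile_sqr_le1 _ _ t0 u0.
    rewrite /s exprMn -mulrA ler_piMr ?sqr_ge0//.
  - by rewrite /s /h smoothstep_ge// subrr mul0r.
have [Cphi _ phi1] := tphi.
exists (radial_field c h s phi) => //.
have div x := divergence_radial_field c h dh s ds phi hh hs Cphi x.
have pr x := profile_le _ _ t0 (sqdist_ge0 c x).
have dp x := dprofile_le0 t (sqdist c x) t0.
have n0 : (0 : R) <= n%:R by [].
have qn x : n%:R * profile t (sqdist c x) + 2 * dprofile t (sqdist c x) * sqdist c x
    <= 2 * n%:R / t.
  have h1 : n%:R * profile t (sqdist c x) <= n%:R * (2 / t) by rewrite ler_wpM2l.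
  have h2 : dprofile t (sqdist c x) * sqdist c x <= 0 by rewrite mulr_le0_ge0// sqdist_ge0.
  have -> : 2 * n%:R / t = n%:R * (2 / t) by ring.
  lra.
split=> x hx; rewrite div /s /ds.
- rewrite /h /dh smoothstep_le// dsmoothstep_out//; last by left.
  by have := qn x; lra.
- set q := sqdist c x in hx *.
  have dle := profile_defect t q t0 (sqdist_ge0 c x) e _ (dotp_le c phi x t (phi1 x) t0) hx.
  have /andP[dh0 dh2] : 0 <= dh q <= 2 / e by exact: dsmoothstep_itv.
  have /andP[h0 h1] := h01 q.
  have := qn x; rewrite -/q.
  set g := (n%:R * _ + _) => gle.
  (* A convex combination of the divergences of [phi] and W, plus the transition term. *)
  have -> : h q * divergence phi x + 2 * dh q * dotp c phi x +
      (n%:R * ((1 - h q) * profile t q) +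
       2 * (- dh q * profile t q + (1 - h q) * dprofile t q) * q) =
     h q * divergence phi x + 2 * dh q * (dotp c phi x - profile t q * q) + (1 - h q) * g.
    by rewrite /g; ring.
  have k1 : h q * divergence phi x <= `|divergence phi x|.
    apply: le_trans (ler_norm _) _; rewrite normrM ger0_norm//.
    by rewrite ler_piMl.
  have k2 : dh q * (dotp c phi x - profile t q * q) <= 2 / e * (e ^+ 2 / (4 * t ^+ 3)).
    (* A negative defect only helps, because the transition is monotone. *)
    have [d0|d0] := leP 0 (dotp c phi x - profile t q * q); first exact: ler_pM.
    apply: (@le_trans _ _ 0); first by rewrite mulr_ge0_le0// ltW.
    by rewrite mulr_ge0 ?divr_ge0 ?sqr_ge0 ?mulr_ge0 ?exprn_ge0// ltW.
  have k3 : 2 / e * (e ^+ 2 / (4 * t ^+ 3)) = e / t ^+ 3 / 2 by field; lra.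
  have k4 : (1 - h q) * g <= 2 * n%:R / t.
    have : 0 <= 2 * n%:R / t by rewrite divr_ge0 ?mulr_ge0// ltW.
    nra.
  lra.
- rewrite /h /dh smoothstep_ge// dsmoothstep_out//; last by right.
  by rewrite subrr; ring.
Qed.

(** The opposite gluing: [phi] inside the ball, W outside. The slope of the weight of [phi] changes
    sign, so the same defect estimate now gives lower bounds. W is not compactly supported and is
    switched off far away. *)
Lemma cut_field c r e Q phi : (2 <= n)%N -> 0 < r -> 0 < e -> r ^+ 2 + e <= Q ->
  test_field phi ->
  exists2 psi, test_field psi &
    [/\ forall x, sqdist c x <= r ^+ 2 -> divergence psi x = divergence phi x,
        forall x, r ^+ 2 <= sqdist c x <= r ^+ 2 + e ->
          - (`|divergence phi x| + e / r ^+ 3) <= divergence psi x,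
        forall x, r ^+ 2 + e <= sqdist c x -> - (8 * r / Q) <= divergence psi x &
        forall rho x, r <= rho -> rho ^+ 2 <= Q -> r ^+ 2 + e <= sqdist c x <= rho ^+ 2 ->
          r ^+ 3 / rho ^+ 4 <= divergence psi x].
Proof.
move=> n2 r0 e0 rQ tphi.
have Q0 : 0 < Q by apply: lt_le_trans rQ; rewrite addr_gt0// exprn_gt0.
pose g := smoothstep (r ^+ 2) e; pose dg := dsmoothstep (r ^+ 2) e.
(* The cutoff acts between squared distances Q and 2 Q. Its slope is at most 2 / Q and W . (x - c)
   <= 2 r, so the loss 8 r / Q can be made as small as desired. *)
pose k u := 1 - smoothstep Q Q u; pose dk u := - dsmoothstep Q Q u.
pose h u := 1 - g u; pose dh u := - dg u.
pose s u := g u * (k u * profile r u).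
pose ds u := dg u * (k u * profile r u) + g u * (dk u * profile r u + k u * dprofile r u).
have hg (u : R) : 0 <= u -> is_derive u 1 g (dg u) by move=> _; exact: is_derive_smoothstep.
have hk (u : R) : 0 <= u -> is_derive u 1 k (dk u).
  by move=> _; apply: is_derive_1B; exact: is_derive_smoothstep.
have cg (u : R) : {for u, continuous dg} by exact: continuous_dsmoothstep.
have ck (u : R) : {for u, continuous dk} by apply: continuousN_at; exact: continuous_dsmoothstep.
have hh (u : R) : 0 <= u -> is_derive u 1 h (dh u) by move=> u0; exact/is_derive_1B/hg.
have ch (u : R) : 0 <= u -> {for u, continuous dh} by move=> _; exact/continuousN_at/cg.
have hkp (u : R) : 0 <= u -> is_derive u 1 (fun u => k u * profile r u)
    (dk u * profile r u + k u * dprofile r u).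
  by move=> u0; apply: is_deriveM_fun; [exact: hk|exact: is_derive_profile].
have hs (u : R) : 0 <= u -> is_derive u 1 s (ds u).
  by move=> u0; apply: is_deriveM_fun; [exact: hg|exact: hkp].
have cs (u : R) : 0 <= u -> {for u, continuous ds}.
  move=> u0; have cp := is_derive_continuous _ _ _ (is_derive_profile _ _ r0 u0).
  have cg' := is_derive_continuous _ _ _ (hg u u0).
  have ck' := is_derive_continuous _ _ _ (hk u u0).
  apply: continuousD_at; apply: continuousM_at => //.
    exact: continuousM_at.
  apply: continuousD_at; apply: continuousM_at => //.
  exact: continuous_dprofile.
have g01 u : 0 <= g u <= 1 by exact: smoothstep_itv.
have k01 u : 0 <= k u <= 1 by have := smoothstep_itv Q Q u; rewrite /k; lra.
have tpsi : test_field (radial_field c h s phi).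
  apply: (test_field_radial c h dh s ds phi (Q + Q)) => // [u u0|u u0|u ut].
  - by have := g01 u; rewrite /h; lra.
  - have p1 := profile_sqr_le1 _ _ r0 u0.
    have -> : 1 - h u = g u by rewrite /h; ring.
    have -> : s u ^+ 2 * u = g u ^+ 2 * (k u ^+ 2 * (profile r u ^+ 2 * u)).
      by rewrite /s; ring.
    rewrite ler_piMr ?sqr_ge0//.
    have /andP[k0 k1] := k01 u.
    have p0 : 0 <= profile r u ^+ 2 * u by apply: mulr_ge0; first exact: sqr_ge0.
    by apply: mulr_ile1 => //; [exact: sqr_ge0|exact: exprn_ile1].
  - by rewrite /s /k smoothstep_ge// subrr mul0r mulr0.
have [Cphi _ phi1] := tphi.
exists (radial_field c h s phi) => //.
have div x := divergence_radial_field c h dh s ds phi hh hs Cphi x.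
have n2' : (2 : R) <= n%:R by rewrite ler_nat.
have far x : r ^+ 2 + e <= sqdist c x -> divergence (radial_field c h s phi) x =
   k (sqdist c x) * (n%:R * profile r (sqdist c x) + 2 * dprofile r (sqdist c x) * sqdist c x)
   + 2 * (dk (sqdist c x) * (profile r (sqdist c x) * sqdist c x)).
  move=> hx; rewrite div /s /ds /h /dh /g /dg smoothstep_ge// dsmoothstep_out//; last by right.
  by ring.
have near x : sqdist c x <= Q -> k (sqdist c x) = 1 /\ dk (sqdist c x) = 0.
  move=> hx; rewrite /k /dk smoothstep_le// dsmoothstep_out//; last by left.
  by rewrite subr0 oppr0.
split=> [x hx|x hx|x hx|rho x rrho rhoQ /andP[hx xrho]].
- rewrite div /s /ds /h /dh /g /dg smoothstep_le// dsmoothstep_out//; last by left.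
  by ring.
- have [k1 dk0] := near x (le_trans (andP hx).2 rQ).
  rewrite div /s /ds /h /dh; rewrite {}k1 {}dk0; set q := sqdist c x in hx *.
  have dle := profile_defect r q r0 (sqdist_ge0 c x) e _ (dotp_le c phi x r (phi1 x) r0) hx.
  have /andP[dg0 dg2] : 0 <= dg q <= 2 / e by exact: dsmoothstep_itv.
  have /andP[g0 g1] := g01 q.
  have := div_profile_ge0 r q r0 (sqdist_ge0 c x) _ n2'.
  set w := (n%:R * profile r q + _) => w0.
  have -> : (1 - g q) * divergence phi x + 2 * - dg q * dotp c phi x +
     (n%:R * (g q * (1 * profile r q)) +
      2 * (dg q * (1 * profile r q) + g q * (0 * profile r q + 1 * dprofile r q)) * q) =
     (1 - g q) * divergence phi x - 2 * (dg q * (dotp c phi x - profile r q * q)) + g q * w.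
    by rewrite /w; ring.
  have l1 : - ((1 - g q) * divergence phi x) <= `|divergence phi x|.
    apply: le_trans (ler_norm _) _; rewrite normrN normrM ger0_norm ?subr_ge0//.
    by rewrite ler_piMl// lerBlDr lerDl.
  have l2 : dg q * (dotp c phi x - profile r q * q) <= 2 / e * (e ^+ 2 / (4 * r ^+ 3)).
    have [d0|d0] := leP 0 (dotp c phi x - profile r q * q); first exact: ler_pM.
    apply: (@le_trans _ _ 0); first by rewrite mulr_ge0_le0// ltW.
    by rewrite mulr_ge0 ?divr_ge0 ?sqr_ge0 ?mulr_ge0 ?exprn_ge0// ltW.
  have l3 : 2 / e * (e ^+ 2 / (4 * r ^+ 3)) = e / r ^+ 3 / 2 by field; lra.
  have l4 : 0 <= g q * w by rewrite mulr_ge0.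
  lra.
- rewrite far//; set q := sqdist c x in hx *.
  have l1 : 0 <= k q * (n%:R * profile r q + 2 * dprofile r q * q).
    by rewrite mulr_ge0 ?div_profile_ge0 ?sqdist_ge0//; have /andP[] := k01 q.
  have /andP[d0 d2] : 0 <= dsmoothstep Q Q q <= 2 / Q by exact: dsmoothstep_itv.
  have p0 : 0 <= profile r q * q by rewrite mulr_ge0 ?profile_ge0 ?sqdist_ge0.
  have l2 : dsmoothstep Q Q q * (profile r q * q) <= 2 / Q * (2 * r).
    by apply: ler_pM => //; exact: profileM_le _ _ r0 (sqdist_ge0 c x).
  have l3 : 8 * r / Q = 2 * (2 / Q * (2 * r)) by ring.
  by rewrite /dk mulNr; lra.
- rewrite far//; have [-> ->] := near x (le_trans xrho rhoQ).
  rewrite mul0r mulr0 addr0 mul1r.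
  exact: div_profile_ge _ _ r0 (sqdist_ge0 c x) _ _ n2' rrho xrho.
Qed.

End cut_and_fill_fields.

(** * Perimeter of unions and intersections with balls *)

Section perimeter_balls.
Context {R : realType} {n : nat}.
Implicit Types (x c : 'rV[R]_n) (phi psi : 'rV[R]_n -> 'rV[R]_n) (A B D E : set 'rV[R]_n).
Local Notation mu := (leb R n).

Lemma leb_measurableD A B : leb_measurable A -> leb_measurable B -> leb_measurable (A `\` B).
Proof. exact: measurableD. Qed.

Lemma leb_measurableU A B : leb_measurable A -> leb_measurable B -> leb_measurable (A `|` B).
Proof. exact: measurableU. Qed.

Lemma leb_measurableI A B : leb_measurable A -> leb_measurable B -> leb_measurable (A `&` B).
Proof. exact: measurableI. Qed.

Lemma le_leb A B : A `<=` B -> (mu A <= mu B)%E.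
Proof. exact: le_leb_outer. Qed.

Lemma leb_ge0 A : (0 <= mu A)%E.
Proof. exact: leb_outer_ge0. Qed.

Lemma leb_lty_sub A B : A `<=` B -> (mu B < +oo)%E -> (mu A < +oo)%E.
Proof. by move=> /le_leb; exact: le_lt_trans. Qed.

Lemma EFin_fine_leb A : (mu A < +oo)%E -> (fine (mu A))%:E = mu A.
Proof. by move=> h; rewrite fineK// ge0_fin_numE// leb_ge0. Qed.

Lemma fine_leb_le A B : A `<=` B -> (mu B < +oo)%E -> fine (mu A) <= fine (mu B).
Proof.
move=> AB Bfin; rewrite -lee_fin !EFin_fine_leb ?le_leb//; exact: leb_lty_sub Bfin.
Qed.

Lemma lebU A B : leb_measurable A -> leb_measurable B -> A `&` B = set0 ->
  mu (A `|` B) = (mu A + mu B)%E.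
Proof. by move=> mA mB AB; exact: (measureU (leb R n) mA mB AB). Qed.

(** The bound s < 2 t gives s^2 - t^2 <= 3 t^2, which keeps the error terms on the shell bounded as
    its volume shrinks. *)
Lemma eball_shell c t d : 0 < t -> 0 < d -> exists s : R,
  [/\ t < s, s < 2 * t, (mu (eball c s `\` eball c t) < +oo)%E &
      fine (mu (eball c s `\` eball c t)) <= d].
Proof.
move=> t0 d0; have [h /andP[h0 ht] hd] := eball_volume_continuous c t d t0 d0.
have sub : eball c (t + h) `\` eball c t `<=` eball c (t + h) `\` eball c (t - h).
  by apply: setDS; apply: subset_eball; lra.
have hd' : (mu (eball c (t + h) `\` eball c t) <= d%:E)%E := le_trans (le_leb _ _ sub) hd.
have hf : (mu (eball c (t + h) `\` eball c t) < +oo)%E.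
  by apply: le_lt_trans hd' _; rewrite ltry.
exists (t + h); split => //; try lra.
by rewrite -lee_fin EFin_fine_leb.
Qed.

(* The competitor is built on the complement of A, where the divergence theorem for
   compactly supported fields turns an upper bound into a lower bound on A. *)
Lemma Per_setU_eball c t A : leb_measurable A -> 0 < t ->
  (Per (A `|` eball c t) <= Per A + (2 * n%:R / t)%:E * mu (eball c t `\` A))%E.
Proof.
move=> mA t0.
have mB s : leb_measurable (eball c s) by exact: measurable_eball.
have mN : leb_measurable (~` A) by exact: measurableC.
apply: Per_le; first exact: leb_measurableU.
move=> phi tphi; have [M MP] := divergence_bounded phi tphi.
have M0 : 0 <= M by apply: le_trans (MP 0).
have n0 : 0 <= 2 * n%:R / t by rewrite divr_ge0 ?mulr_ge0// ltW.
have t30 : 0 < t ^+ 3 by exact: exprn_gt0.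
(* Bounds the divergence of the glued field on the shell; the shell is then chosen so thin that it
   contributes at most [del], counting both fields. *)
pose C := M + 3 / t + 2 * n%:R / t.
have C0 : 0 < C by rewrite /C ltr_wpDr// ltr_wpDl// divr_gt0.
apply/lee_addgt0Pr => del del0.
have [|s [ts s2t Sfin Sd]] := eball_shell c t (del / (C + M)) t0.
  by rewrite divr_gt0// ltr_wpDr.
set S := eball c s `\` eball c t in Sfin Sd.
pose e := s ^+ 2 - t ^+ 2.
have e0 : 0 < e by rewrite /e; nra.
have [psi tpsi [H1 H2 H3]] := fill_field c t e phi t0 e0 tphi.
have te : t ^+ 2 + e = s ^+ 2 by rewrite /e; ring.
have eC : e / t ^+ 3 <= 3 / t.
  rewrite ler_pdivrMr// (_ : 3 / t * _ = 3 * t ^+ 2); last by field; lra.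
  by rewrite /e; nra.
have BA_fin : (mu (eball c t `\` A) < +oo)%E.
  by apply: leb_lty_sub (leb_eball_lty c t); exact: subDsetl.
rewrite -(EFin_fine_leb _ BA_fin) -EFinM.
apply: le_trans (_ :
    ((div_int A psi + (2 * n%:R / t) * fine (mu (eball c t `\` A)) + del)%:E <= _)%E).
  rewrite lee_fin.
  (* The complement of [A] splits into its part in the ball, in the shell and beyond; the last two
     form the complement of the union. *)
  pose N0 := eball c t `\` A; pose N1 := ~` A `&` S; pose N2 := ~` A `\` eball c s.
  have mN0 : leb_measurable N0 by exact: leb_measurableD.
  have mS : leb_measurable S by exact: leb_measurableD.
  have mN1 : leb_measurable N1 by exact: leb_measurableI.
  have mN2 : leb_measurable N2 by exact: leb_measurableD.
  have ball_ts : eball c t `<=` eball c s by apply: subset_eball; lra.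
  have N12 : ~` (A `|` eball c t) = N1 `|` N2.
    apply/seteqP; split=> [x /not_orP[Ax tx]|x].
      by have [sx|sx] := pselect (eball c s x); [left|right].
    move=> [[Ax [_ tx]]|[Ax sx]] []//.
    by move=> /ball_ts.
  have N012 : ~` A = N0 `|` (N1 `|` N2).
    rewrite -N12; apply/seteqP; split=> [x Ax|x [[]//|]].
      by have [tx|tx] := pselect (eball c t x); [left|right => -[]].
    by move=> h Ax; apply: h; left.
  have d12 : N1 `&` N2 = set0.
    by apply/seteqP; split=> // x [[_ [sx _]] [_ nsx]].
  have d0 : N0 `&` (N1 `|` N2) = set0.
    by rewrite -N12; apply/seteqP; split=> // x [[tx _]] h; apply: h; right.
  have N1fin : (mu N1 < +oo)%E by apply: leb_lty_sub Sfin; exact: subIsetr.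
  have N1d : fine (mu N1) <= del / (C + M).
    by apply: le_trans Sd; apply: fine_leb_le => //; exact: subIsetr.
  have m0 : 0 <= fine (mu N1) by rewrite fine_ge0// leb_ge0.
  have E1 := div_int_setC _ _ tphi (leb_measurableU _ _ mA (mB t)).
  have E2 := div_int_setC _ _ tpsi mA.
  rewrite N12 div_intU// in E1; rewrite N012 div_intU// in E2; last exact: leb_measurableU.
  rewrite div_intU// in E2.
  have I0 : div_int N0 psi <= 2 * n%:R / t * fine (mu N0).
    by apply: (div_int_le_cst _ _ _ tpsi mN0 BA_fin) => x [tx _]; apply: H1; exact: ltW.
  have I1 : div_int N1 psi <= C * fine (mu N1).
    apply: (div_int_le_cst _ _ _ tpsi mN1 N1fin) => x [_ [sx /negP]]; rewrite -leNgt => tx.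
    apply: le_trans (H2 x _) _; first by rewrite tx te ltW.
    by rewrite /C lerD2r lerD.
  have I2 : div_int N2 psi = div_int N2 phi.
    apply: eq_div_int => x [_ /negP]; rewrite -leNgt => sx.
    by apply: H3; rewrite te.
  have I3 : - M * fine (mu N1) <= div_int N1 phi.
    apply: (div_int_ge_cst _ _ _ tphi mN1 N1fin) => x _.
    by have := MP x; rewrite ler_norml => /andP[h _]; exact: h.
  have I4 : (C + M) * fine (mu N1) <= del.
    have CM0 : 0 < C + M by rewrite ltr_wpDr.
    by rewrite mulrC -ler_pdivlMr//; exact: N1d.
  rewrite -/N0 -[div_int _ phi]opprK -E1 -[div_int A psi]opprK -E2 I2.
  move: I0 I1 I3 I4; clearbody C; clear.
  move: (div_int N0 psi) (div_int N1 psi) (div_int N2 phi) (div_int N1 phi) (fine _) (fine _).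
  move=> *; lra.
rewrite !EFinD; apply: leeD => //; apply: leeD => //.
exact: le_Per.
Qed.

(* r^3 / rho^4 bounds div W from below on [eball c rho]; only positivity matters. *)
Lemma Per_setI_eball c (r rho : R) E : (2 <= n)%N -> leb_measurable E -> (mu E < +oo)%E ->
  0 < r -> r <= rho ->
  (Per (E `&` eball c r) + (r ^+ 3 / rho ^+ 4)%:E * mu (E `&` (eball c rho `\` eball c r))
     <= Per E)%E.
Proof.
move=> n2 mE Efin r0 rrho.
have mB s : leb_measurable (eball c s) by exact: measurable_eball.
have rho0 : 0 < rho by exact: lt_le_trans rrho.
pose k : R := r ^+ 3 / rho ^+ 4; rewrite -/k.
have k0 : 0 < k by rewrite divr_gt0 ?exprn_gt0.
set D := E `&` (eball c rho `\` eball c r).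
have Dfin : (mu D < +oo)%E by apply: leb_lty_sub Efin; exact: subIsetl.
rewrite -(EFin_fine_leb _ Dfin) -EFinM -leeBrDr//.
apply: Per_le; first exact: leb_measurableI.
move=> phi tphi; have [M MP] := divergence_bounded phi tphi.
rewrite leeBrDr// -EFinD.
have M0 : 0 <= M by apply: le_trans (MP 0).
pose C := M + 3 / r.
have C0 : 0 < C by rewrite /C ltr_wpDl// divr_gt0.
apply/lee_addgt0Pr => del del0.
(* Half of [del] pays for the shell, the other half for the far cutoff. The summand [k] accounts for
   the part of [D] in the shell, where the gain is lost. *)
have [|s [rs s2r Sfin Sd]] := eball_shell c r (del / 2 / (C + k)) r0.
  by rewrite !divr_gt0// addr_gt0.
set S := eball c s `\` eball c r in Sfin Sd.
pose e := s ^+ 2 - r ^+ 2.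
have e0 : 0 < e by rewrite /e; nra.
have r30 : 0 < r ^+ 3 by exact: exprn_gt0.
have eC : e / r ^+ 3 <= 3 / r.
  rewrite ler_pdivrMr// (_ : 3 / r * _ = 3 * r ^+ 2); last by field; rewrite gt_eqF.
  by rewrite /e; nra.
set mE' := fine (mu E).
have mE0 : 0 <= mE' by rewrite fine_ge0// leb_ge0.
(* The first two summands keep the ball of radius rho and the shell inside the region without
   cutoff; the third makes 8 r / Q times the volume of [E] at most del / 2, which uses that this
   volume is finite. *)
pose Q := rho ^+ 2 + s ^+ 2 + 16 * r * mE' / del.
have q0 : 0 <= 16 * r * mE' / del by rewrite divr_ge0 ?mulr_ge0// ltW.
have re : r ^+ 2 + e = s ^+ 2 by rewrite /e; ring.
have rQ : r ^+ 2 + e <= Q by rewrite re /Q; have := sqr_ge0 rho; lra.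
have rhoQ : rho ^+ 2 <= Q by rewrite /Q; have := sqr_ge0 s; lra.
have Q0 : 0 < Q by apply: lt_le_trans rhoQ; rewrite exprn_gt0.
have Q8 : 0 <= 8 * r / Q by rewrite divr_ge0 ?mulr_ge0// ltW.
have QE : 8 * r / Q * mE' <= del / 2.
  rewrite mulrAC ler_pdivrMr//.
  have : 16 * r * mE' / del <= Q by rewrite /Q; have := sqr_ge0 s; have := sqr_ge0 rho; lra.
  by rewrite ler_pdivrMr//; lra.
have [psi tpsi [H1 H2 H3 H4]] := cut_field c r e Q phi n2 r0 e0 rQ tphi.
apply: (@le_trans _ _ ((div_int E psi + del)%:E)); last by rewrite EFinD leeD2r// le_Per.
rewrite lee_fin.
(* Four regions: [phi] unchanged, transition shell, uniform gain from div W, and far region with a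
   small loss. *)
pose E0 := E `&` eball c r; pose E1 := E `&` S.
pose E2 := E `&` (eball c rho `\` eball c s); pose E3 := (E `\` eball c s) `\` eball c rho.
have mE0' : leb_measurable E0 by exact: leb_measurableI.
have mS : leb_measurable S by exact: leb_measurableD.
have mE1 : leb_measurable E1 by exact: leb_measurableI.
have mE2 : leb_measurable E2 by apply: leb_measurableI => //; exact: leb_measurableD.
have mE3 : leb_measurable E3 by apply: leb_measurableD => //; exact: leb_measurableD.
have ball_rs : eball c r `<=` eball c s by apply: subset_eball; lra.
have EE : E = E0 `|` (E1 `|` (E2 `|` E3)).
  apply/seteqP; split=> [x Ex|x]; last by move=> [[]//|[[]//|[[]//|[[]//]]]].
  have [rx|rx] := pselect (eball c r x); first by left.
  have [sx|sx] := pselect (eball c s x); first by right; left.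
  by have [ox|ox] := pselect (eball c rho x); right; right; [left|right].
have d0 : E0 `&` (E1 `|` (E2 `|` E3)) = set0.
  apply/seteqP; split=> // x [[_ rx] [[_ [_ /(_ rx)]]//|[[_ [_]]|[[_]]]]].
    by move=> /(_ (ball_rs _ rx)).
  by move=> /(_ (ball_rs _ rx)).
have d1 : E1 `&` (E2 `|` E3) = set0.
  by apply/seteqP; split=> // x [[_ [sx _]] [[_ [_ /(_ sx)]]//|[[_ /(_ sx)]]//]].
have d12 : E1 `&` E2 = set0.
  by apply/seteqP; split=> // x [[_ [sx _]] [_ [_ /(_ sx)]]].
have d2 : E2 `&` E3 = set0.
  by apply/seteqP; split=> // x [[_ [ox _]] [_ /(_ ox)]].
have fin D' : D' `<=` E -> (mu D' < +oo)%E by move=> /leb_lty_sub; apply.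
have E1E : E1 `<=` E by exact: subIsetl.
have E2E : E2 `<=` E by exact: subIsetl.
have E3E : E3 `<=` E by move=> x [[]].
have E1d : fine (mu E1) <= del / 2 / (C + k).
  by apply: le_trans Sd; apply: fine_leb_le => //; exact: subIsetr.
have m1 : 0 <= fine (mu E1) by rewrite fine_ge0// leb_ge0.
have m3 : fine (mu E3) <= mE' by exact: fine_leb_le.
have I : div_int E psi = div_int E0 psi + (div_int E1 psi + (div_int E2 psi + div_int E3 psi)).
  rewrite {1}EE div_intU//; last by do 2 apply: leb_measurableU => //.
  by rewrite div_intU//; [rewrite div_intU|exact: leb_measurableU].
have I0 : div_int E0 psi = div_int E0 phi by apply: eq_div_int => x [_ rx]; apply: H1; exact: ltW.
have I1 : - C * fine (mu E1) <= div_int E1 psi.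
  apply: (div_int_ge_cst _ _ _ tpsi mE1 (fin _ E1E)) => x [_ [sx /negP]]; rewrite -leNgt => rx.
  apply: le_trans (H2 x _); last by rewrite rx re ltW.
  by rewrite /C lerN2 lerD.
have I2 : k * fine (mu E2) <= div_int E2 psi.
  apply: (div_int_ge_cst _ _ _ tpsi mE2 (fin _ E2E)) => x [_ [ox /negP]]; rewrite -leNgt => sx.
  by apply: (H4 rho x rrho rhoQ); rewrite re sx ltW.
have I3 : - (8 * r / Q) * fine (mu E3) <= div_int E3 psi.
  apply: (div_int_ge_cst _ _ _ tpsi mE3 (fin _ E3E)) => x [[_ /negP]]; rewrite -leNgt => sx _.
  by apply: H3; rewrite re; exact: sx.
have I4 : fine (mu D) <= fine (mu E1) + fine (mu E2).
  rewrite -lee_fin EFinD !EFin_fine_leb; [|exact: fin|exact: fin|by []].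
  rewrite -(lebU _ _ mE1 mE2 d12); apply: le_leb => y [Ey [oy ry]].
  have [sy|sy] := pselect (eball c s y); [left|right]; split; try exact: Ey.
  by split; [exact: sy|exact: ry].
  by split; [exact: oy|exact: sy].
have I5 : (C + k) * fine (mu E1) <= del / 2.
  have Ck0 : 0 < C + k by exact: addr_gt0.
  by rewrite mulrC -ler_pdivlMr//; exact: E1d.
have I6 : 8 * r / Q * fine (mu E3) <= del / 2.
  by apply: le_trans QE; exact: ler_wpM2l Q8 _ _ m3.
have I7 : k * fine (mu D) <= k * (fine (mu E1) + fine (mu E2)) by rewrite ler_pM2l.
rewrite I I0; move: I1 I2 I3 I5 I6 I7; clearbody C k Q; clear.
move: (div_int E0 phi) (div_int E1 psi) (div_int E2 psi) (div_int E3 psi).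
move: (fine (mu D)) (fine (mu E1)) (fine (mu E2)) (fine (mu E3)) (8 * r / Q).
move=> *; lra.
Qed.

End perimeter_balls.

(** * Exact perimeters and volumes *)

(* The solution is the supremum of the sublevel set {t in [0, b] | f t <= L}. *)
Lemma ereal_semicontinuous_ivt (R : realType) (f : R -> \bar R) (L b : R) : 0 <= b ->
  (f 0%R <= L%:E)%E -> (L%:E < f b)%E ->
  (forall t : R, 0 < t <= b ->
     (forall s : R, 0 <= s < t -> exists2 s', s < s' < t & (f s' <= L%:E)%E) ->
     (f t <= L%:E)%E) ->
  (forall t d : R, 0 <= t < b -> 0 < d -> exists2 s, t < s <= b & (f s <= f t + d%:E)%E) ->
  exists2 t, 0 <= t < b & f t = L%:E.
Proof.
move=> b0 f0 fb left right.
pose S := [set t : R | 0 <= t <= b /\ (f t <= L%:E)%E].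
have S0 : S 0 by split; rewrite ?lexx.
have supS : has_sup S by split; [exists 0|exists b => t [/andP[]]].
set t0 := sup S.
have t00 : 0 <= t0 by exact: (ub_le_sup supS.2).
have t0b : t0 <= b by apply: ge_sup; [exists 0|move=> t [/andP[]]].
have ft0 : (f t0 <= L%:E)%E.
  have [->//|t0_neq0] := eqVneq t0 0.
  apply: contrapT => nft0; apply: (nft0); apply: left => [|s /andP[s0 st]].
    by rewrite t0b lt_neqAle eq_sym t0_neq0 t00.
  have ts0 : 0 < t0 - s by rewrite subr_gt0.
  have [s' Ss'] := sup_adherent ts0 supS.
  rewrite -/t0 subKr => ss'; exists s'; last by case: Ss'.
  rewrite ss'/= lt_neqAle (ub_le_sup supS.2)// andbT.
  by apply/eqP => e; apply: nft0; rewrite -e; case: Ss'.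
have t0b' : t0 < b.
  rewrite lt_neqAle t0b andbT; apply/eqP => e.
  by move: fb; rewrite -e ltNge ft0.
exists t0; first by rewrite t00.
apply/eqP; rewrite eq_le ft0/=; apply/lee_addgt0Pr => d d0.
(* Points to the right of the supremum lie outside the sublevel set, so L < f s <= f t0 + d. *)
have [s /andP[ts sb] fs] := right t0 d ltac:(by rewrite t00) d0.
apply: le_trans fs; rewrite leNgt; apply/negP => /ltW fs.
suff : s <= t0 by rewrite leNgt ts.
by apply: (ub_le_sup supS.2); split => //; rewrite sb (le_trans t00)// ltW.
Qed.

Section ball_filling.
Context {R : realType} {n : nat}.
Implicit Types (x c : 'rV[R]_n) (phi : 'rV[R]_n -> 'rV[R]_n) (A B D E F G : set 'rV[R]_n).
Local Notation mu := (leb R n).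

(** The square beats the factor 1 / s of [Per_setU_eball] as the radius tends to 0. *)
Lemma leb_eball_le_sqr c (s : R) : (2 <= n)%N -> 0 < s -> s <= 1 ->
  fine (mu (eball c s)) <= s ^+ 2 * fine (mu (eball c 1)).
Proof.
move=> n2 s0 s1; rewrite -lee_fin EFinM !EFin_fine_leb; try exact: leb_eball_lty.
have := leb_eball_scale c 1 s ltr01 s0; rewrite divr1; move/le_trans; apply.
apply: lee_wpmul2r; first exact: leb_ge0.
by rewrite lee_fin ler_wiXn2l// ltW.
Qed.

(** Turns the left hypothesis of [ereal_semicontinuous_ivt] into a radius with property [P] that is
    close to t in volume. *)
Lemma eball_left_approx c (t d : R) (P : R -> Prop) : 0 < t -> 0 < d ->
  (forall s : R, 0 <= s < t -> exists2 s', s < s' < t & P s') ->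
  exists s, [/\ 0 < s, s < t, P s & (mu (eball c t `\` eball c s) <= d%:E)%E].
Proof.
move=> t0 d0 H; have [h /andP[h0 ht] hd] := eball_volume_continuous c t d t0 d0.
have [|s /andP[hs st] Ps] := H (t - h); first by lra.
exists s; split => //; first by lra.
apply: le_trans hd; apply: le_leb => x [tx sx]; split.
  by apply: subset_eball tx; lra.
by move=> hx; apply: sx; apply: subset_eball hx; lra.
Qed.

Lemma div_int_le_setD phi A B (M : R) : test_field phi -> leb_measurable A -> leb_measurable B ->
  (mu (B `\` A) < +oo)%E -> (forall x, `|divergence phi x| <= M) -> A `<=` B ->
  div_int B phi <= div_int A phi + M * fine (mu (B `\` A)).
Proof.
move=> tphi mA mB fin MP AB; have mBA := leb_measurableD _ _ mB mA.
have e : B = A `|` (B `\` A) by rewrite setDUK.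
rewrite {1}e div_intU//; last by rewrite setDE setICA setICr setI0.
rewrite lerD2l; apply: (div_int_le_cst _ _ _ tphi mBA fin) => x _.
exact: le_trans (ler_norm _) (MP x).
Qed.

Lemma fill_ball_perimeter c A (L b : R) : (2 <= n)%N -> leb_measurable A -> 0 <= b ->
  (Per A <= L%:E)%E -> (L%:E < Per (A `|` eball c b))%E ->
  exists2 t, 0 <= t < b & Per (A `|` eball c t) = L%:E.
Proof.
move=> n2 mA b0 LA Lb.
have mU s : leb_measurable (A `|` eball c s).
  by apply: leb_measurableU => //; exact: measurable_eball.
apply: (ereal_semicontinuous_ivt _ (fun t => Per (A `|` eball c t))) => //.
- by rewrite eball0 setU0.
(* Left lower semicontinuity: for a fixed test field the integral changes by at most a multiple of
   the shell volume. *)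
- move=> t /andP[t0 tb] H; apply: Per_le => // phi tphi.
  have [M MP] := divergence_bounded phi tphi.
  have M0 : 0 <= M by apply: le_trans (MP 0).
  apply/lee_addgt0Pr => d d0.
  have d1 : 0 < d / (M + 1) by rewrite divr_gt0// ltr_wpDl.
  have [s [s0 st Ps sd]] := eball_left_approx c t _ _ t0 d1 H.
  have sub : (A `|` eball c t) `\` (A `|` eball c s) `<=` eball c t `\` eball c s.
    move=> x [[Ax|tx] nx]; first by case: nx; left.
    by split=> // sx; apply: nx; right.
  have fin1 : (mu (eball c t `\` eball c s) < +oo)%E by apply: le_lt_trans sd _; rewrite ltry.
  have fin2 := leb_lty_sub _ _ sub fin1.
  apply: (@le_trans _ _ (div_int (A `|` eball c s) phi + d)%:E).
    rewrite lee_fin; apply: le_trans (div_int_le_setD _ _ _ M tphi (mU s) (mU t) fin2 MP _) _.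
      by apply: setUS; apply: subset_eball; apply: ltW.
    rewrite lerD2l.
    have h1 := fine_leb_le _ _ sub fin1.
    have h2 : fine (mu (eball c t `\` eball c s)) <= d / (M + 1).
      by rewrite -lee_fin EFin_fine_leb.
    have h3 := le_trans h1 h2.
    have h4 : 0 <= d / (M + 1) := ltW d1.
    apply: (le_trans (ler_wpM2l M0 h3)).
    by rewrite mulrA ler_pdivrMr ?ltr_wpDl//; nra.
  rewrite EFinD leeD2r//; apply: le_trans Ps; exact: le_Per.
(* Right upper semicontinuity: enlarging the ball from s' to s is the union of the set already
   filled with the ball of radius s, so [Per_setU_eball] applies to the shell. *)
- move=> t d /andP[t0 tb] d0.
  have U s s' : s' <= s -> 0 <= s' -> 0 < s ->
      (Per (A `|` eball c s) <= Per (A `|` eball c s') +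
         (2 * n%:R / s)%:E * mu (eball c s `\` eball c s'))%E.
    move=> s's s'0 s0.
    have -> : A `|` eball c s = (A `|` eball c s') `|` eball c s.
      rewrite -setUA; congr (_ `|` _); rewrite setUidr//; exact: subset_eball.
    apply: le_trans (Per_setU_eball c s _ (mU s') s0) _; rewrite leeD2l//.
    apply: lee_wpmul2l; first by rewrite lee_fin divr_ge0 ?mulr_ge0// ltW.
    by apply: le_leb; apply: setDS; right.
  have n0 : (0 : R) < n%:R by rewrite ltr0n (leq_trans _ n2).
  (* At t = 0 the factor 1 / s blows up; the volume bound in s^2 leaves s times a constant, and s is
     chosen accordingly. *)
  move: t0; rewrite le_eqVlt => /orP[/eqP t0|t0].
    rewrite -{}t0 in tb *.
    set V := fine (mu (eball c 1)).
    have V0 : 0 <= V by rewrite fine_ge0// leb_ge0.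
    have nV : 0 < 2 * n%:R * V + 1 by rewrite ltr_wpDl// !mulr_ge0// ltW.
    pose s := Num.min b (Num.min 1 (d / (2 * n%:R * V + 1))).
    have s0 : 0 < s by rewrite !lt_min tb ltr01 divr_gt0.
    have sb : s <= b by rewrite ge_min lexx.
    have s1 : s <= 1 by rewrite !ge_min lexx orbT.
    have sd : s <= d / (2 * n%:R * V + 1) by rewrite !ge_min lexx !orbT.
    exists s; first by rewrite s0 sb.
    apply: le_trans (U s 0 (ltW s0) (lexx 0) s0) _; rewrite leeD2l// eball0 setD0.
    rewrite -(EFin_fine_leb _ (leb_eball_lty c s)) -EFinM lee_fin.
    have h := leb_eball_le_sqr c s n2 s0 s1.
    have s0' : 0 <= 2 * n%:R / s by rewrite divr_ge0 ?mulr_ge0// ltW.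
    apply: (le_trans (ler_wpM2l s0' h)); rewrite -/V.
    have -> : 2 * n%:R / s * (s ^+ 2 * V) = s * (2 * n%:R * V) by field; rewrite gt_eqF.
    apply: (@le_trans _ _ (s * (2 * n%:R * V + 1))).
      by rewrite ler_pM2l// lerDl.
    by rewrite -ler_pdivlMr.
  have k0 : 0 < 2 * n%:R / t by rewrite divr_gt0// mulr_gt0.
  have [|s1 [ts1 _ fin sd]] := eball_shell c t (d / (2 * n%:R / t)) t0.
    by rewrite divr_gt0.
  pose s := Num.min b s1.
  have ts : t < s by rewrite lt_min tb ts1.
  have sb : s <= b by rewrite ge_min lexx.
  have ss1 : s <= s1 by rewrite ge_min lexx orbT.
  have s0 : 0 < s by exact: lt_trans ts.
  exists s; first by rewrite ts sb.
  apply: le_trans (U s t (ltW ts) (ltW t0) s0) _; rewrite leeD2l//.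
  have sub : eball c s `\` eball c t `<=` eball c s1 `\` eball c t.
    by apply: setSD; apply: subset_eball => //; exact: ltW.
  have fins := leb_lty_sub _ _ sub fin.
  rewrite -(EFin_fine_leb _ fins) -EFinM lee_fin.
  have h1 := le_trans (fine_leb_le _ _ sub fin) sd.
  apply: (@le_trans _ _ (2 * n%:R / t * fine (mu (eball c s `\` eball c t)))).
    apply: ler_wpM2r; first by rewrite fine_ge0// leb_ge0.
    by rewrite ler_pM2l ?mulr_gt0// lef_pV2 ?posrE//; exact: ltW.
  by rewrite mulrC -ler_pdivlMr.
Qed.

End ball_filling.

(** * Exhaustion by balls, and strict decrease of the perimeter under cuts *)

Section strict_cut.
Context {R : realType} {n : nat}.
Implicit Types (x c : 'rV[R]_n) (phi : 'rV[R]_n -> 'rV[R]_n) (A B D E F G : set 'rV[R]_n).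
Local Notation mu := (leb R n).

Lemma increasing_union_volume (H : nat -> set 'rV[R]_n) (a : \bar R) :
  (forall k, leb_measurable (H k)) -> (forall k, H k `<=` H k.+1) ->
  (a < mu (\bigcup_k H k))%E -> exists k, (a < mu (H k))%E.
Proof.
move=> mH sH aH.
have ndH : nondecreasing_seq H by apply/nondecreasing_seqP => k; rewrite subsetEset.
have := @nondecreasing_cvg_mu _ _ _ (leb R n) H mH (bigcupT_measurable _ mH) ndH.
move=> cv; apply: contrapT => /forallNP nH.
suff : (mu (\bigcup_k H k) <= a)%E by rewrite leNgt aH.
have := cvg_lim _ cv; move=> <- //; apply: lime_le; first by apply/cvg_ex; eexists; exact: cv.
by apply: nearW => k; rewrite /= leNgt; apply/negP/nH.
Qed.

Lemma decreasing_volume_small (H : nat -> set 'rV[R]_n) (d : R) :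
  (forall k, leb_measurable (H k)) -> (forall k, H k.+1 `<=` H k) ->
  (mu (H 0%N) < +oo)%E -> \bigcap_k H k = set0 -> 0 < d -> exists k, (mu (H k) < d%:E)%E.
Proof.
move=> mH sH finH H0 d0.
have niH : nonincreasing_seq H by apply/nonincreasing_seqP => k; rewrite subsetEset.
have := @nonincreasing_cvg_mu _ _ _ (leb R n) H finH mH (bigcapT_measurable mH) niH.
rewrite H0 measure0 => cv; apply: contrapT => /forallNP nH.
suff : (d%:E <= 0)%E by rewrite leNgt lte_fin d0.
have := cvg_lim _ cv; move=> <- //; apply: lime_ge; first by apply/cvg_ex; eexists; exact: cv.
by apply: nearW => k; rewrite /= leNgt; apply/negP/nH.
Qed.

(** The union may have infinite volume, so continuity from above is applied only inside a ball off
    which the divergence vanishes. This gives lower semicontinuity of the perimeter along the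
    chain. *)
Lemma div_int_increasing_union phi (H : nat -> set 'rV[R]_n) (d : R) : test_field phi ->
  (forall k, leb_measurable (H k)) -> (forall k, H k `<=` H k.+1) -> 0 < d ->
  exists k, div_int (\bigcup_k H k) phi <= div_int (H k) phi + d.
Proof.
move=> tphi mH sH d0; set G := \bigcup_k H k.
have mG : leb_measurable G by exact: bigcupT_measurable.
have [_ supp _] := tphi; have [T TP] := divergence_support _ supp.
have [M MP] := divergence_bounded phi tphi.
have M0 : 0 <= M by apply: le_trans (MP 0).
pose K : set 'rV[R]_n := eball 0 (`|T| + 1).
have mK : leb_measurable K by exact: measurable_eball.
have mGH k : leb_measurable (G `\` H k) by exact: leb_measurableD.
have mD k : leb_measurable ((G `\` H k) `&` K) by exact: leb_measurableI.
have d1 : 0 < d / (M + 1) by rewrite divr_gt0// ltr_wpDl.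
have [|||||k kd] := decreasing_volume_small (fun k => (G `\` H k) `&` K) (d / (M + 1)).
- exact: mD.
- by move=> k x [[Gx nx] Kx]; split=> //; split=> // Hx; apply: nx; exact: sH.
- by apply: leb_lty_sub (leb_eball_lty 0 (`|T| + 1)); exact: subIsetr.
- by apply/seteqP; split=> // x h; have [[[j _ Hj] _] _] := h 0%N I; have [[_ /(_ Hj)]] := h j I.
- exact: d1.
exists k.
have sHG : H k `<=` G by move=> x Hx; exists k.
have mR : leb_measurable ((G `\` H k) `\` K) by exact: leb_measurableD.
have fin : (mu ((G `\` H k) `&` K) < +oo)%E by apply: lt_trans kd _; rewrite ltry.
have d2 : (G `\` H k) `&` K `&` ((G `\` H k) `\` K) = set0.
  by apply/seteqP; split=> // x [[_ Kx] [_ /(_ Kx)]].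
have e1 : div_int (G `\` H k) phi =
    div_int ((G `\` H k) `&` K) phi + div_int ((G `\` H k) `\` K) phi.
  by rewrite -{1}(setUIDK (G `\` H k) K) (div_intU _ _ _ tphi (mD k) mR d2).
have e2 : div_int G phi = div_int (H k) phi + div_int (G `\` H k) phi.
  by rewrite -{1}(setDUK sHG) (div_intU _ _ _ tphi (mH k) (mGH k) (setDIK _ _)).
have e3 : div_int ((G `\` H k) `\` K) phi = 0.
  have t0 := @test_field0 R n.
  rewrite (eq_div_int phi (fun=> 0)); last first.
    by move=> x [_ /eball_support/TP ->]; rewrite divergence0.
  apply: EFin_inj; rewrite (EFin_div_int _ _ t0 mR).
  by rewrite integral0_eq// => x _; rewrite divergence0.
have e4 : div_int ((G `\` H k) `&` K) phi <= M * fine (mu ((G `\` H k) `&` K)).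
  apply: (div_int_le_cst _ _ _ tphi (mD k) fin) => x _.
  exact: le_trans (ler_norm _) (MP x).
have e5 : fine (mu ((G `\` H k) `&` K)) <= d / (M + 1).
  by rewrite -lee_fin (EFin_fine_leb _ fin); exact: ltW.
have e6 : M * fine (mu ((G `\` H k) `&` K)) <= d.
  apply: (le_trans (ler_wpM2l M0 e5)).
  by rewrite mulrA ler_pdivrMr ?ltr_wpDl//; nra.
by rewrite e2 e1 e3 addr0 lerD2l; exact: le_trans e4 e6.
Qed.

Fixpoint fill_balls (F : set 'rV[R]_n) (c : nat -> 'rV[R]_n) (r : nat -> R) k :=
  if k is k'.+1 then fill_balls F c r k' `|` eball (c k') (r k') else F.

Section fill_balls.
Variables (F : set 'rV[R]_n) (c : nat -> 'rV[R]_n) (r : nat -> R).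
Hypothesis mF : leb_measurable F.

Lemma measurable_fill_balls k : leb_measurable (fill_balls F c r k).
Proof. by elim: k => //= k IH; apply: leb_measurableU => //; exact: measurable_eball. Qed.

Lemma fill_balls_subS k : fill_balls F c r k `<=` fill_balls F c r k.+1.
Proof. by move=> x; left. Qed.

Lemma sub_fill_balls k : F `<=` fill_balls F c r k.
Proof. by elim: k => //= k IH x /IH; left. Qed.

Lemma fill_balls_sub G k : F `<=` G -> (forall j, eball (c j) (r j) `<=` G) ->
  fill_balls F c r k `<=` G.
Proof. by move=> FG cG; elim: k => //= k IH x [/IH|/cG]. Qed.

Lemma bigcup_fill_balls : \bigcup_k fill_balls F c r k = F `|` \bigcup_k eball (c k) (r k).
Proof.
apply/seteqP; split=> [x [k _]|x [Fx|[k _ kx]]]; last 2 first.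
- by exists 0%N.
- by exists k.+1 => //=; right.
elim: k => [|k IH]/=; first by left.
by move=> [/IH|kx]; [|right; exists k].
Qed.

Lemma leb_fill_balls_lty k : (mu F < +oo)%E -> (mu (fill_balls F c r k) < +oo)%E.
Proof.
move=> finF; elim: k => //= k IH.
apply: (@le_lt_trans _ _ (mu (fill_balls F c r k) + mu (eball (c k) (r k)))%E).
  exact: (@measureU2 _ _ _ (leb R n) _ _ (measurable_fill_balls k) (measurable_eball _ _)).
by apply: lte_add_pinfty => //; exact: leb_eball_lty.
Qed.

Lemma Per_fill_balls_lty k : (forall j, 0 <= r j) -> (Per F < +oo)%E ->
  (Per (fill_balls F c r k) < +oo)%E.
Proof.
move=> r0 PF; elim: k => //= k IH.
(* Radius 0 occurs as padding in [open_eball_cover] and adds the empty set. *)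
have [rk|] := ltP 0 (r k); last first.
  by move=> rk; have -> : r k = 0 by [apply/eqP; rewrite eq_le rk r0]; rewrite eball0 setU0.
apply: le_lt_trans (Per_setU_eball (c k) (r k) _ (measurable_fill_balls k) rk) _.
apply: lte_add_pinfty => //.
have fin : (mu (eball (c k) (r k) `\` fill_balls F c r k) < +oo)%E.
  by apply: leb_lty_sub (leb_eball_lty (c k) (r k)); exact: subDsetl.
by rewrite -(EFin_fine_leb _ fin) -EFinM ltry.
Qed.

End fill_balls.

(** If no set of the chain filling [G] had perimeter above L, semicontinuity would give Per G <= L.
    So some ball makes the perimeter cross L, and shrinking that ball yields the value exactly. *)
Lemma exists_superset_Per G F (L : R) : (2 <= n)%N -> open G -> leb_measurable F ->
  F `<=` G -> (mu F < +oo)%E -> (Per F < L%:E)%E -> (L%:E < Per G)%E ->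
  exists F', [/\ leb_measurable F', F `<=` F', F' `<=` G, (mu F' < +oo)%E & Per F' = L%:E].
Proof.
move=> n2 oG mF FG finF PF PG.
have [c [r [r0 rG Gr]]] := open_eball_cover G oG.
pose H := fill_balls F c r.
have HG : \bigcup_k H k = G.
  rewrite bigcup_fill_balls; apply/seteqP; split=> [x [/FG//|[k _ /rG//]]|x /Gr]; by right.
have [k0 Lk0] : exists k, (L%:E < Per (H k))%E.
  apply: contrapT => /forallNP nH; move: PG; rewrite ltNge => /negP; apply.
  apply: Per_le => [|phi tphi]; first exact: open_leb_measurable.
  apply/lee_addgt0Pr => d d0.
  have [k kd] := div_int_increasing_union phi H d tphi (measurable_fill_balls F c r mF)
    (fill_balls_subS F c r) d0.
  rewrite HG in kd; apply: (@le_trans _ _ (div_int (H k) phi + d)%:E); first by rewrite lee_fin.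
  rewrite EFinD leeD2r//; apply: (@le_trans _ _ (Per (H k))).
    by apply: le_Per => //; exact: measurable_fill_balls.
  by rewrite leNgt; apply/negP/nH.
(* The first index with perimeter above L is positive because Per F < L; its predecessor has
   perimeter at most L. *)
pose m := ex_minn (ex_intro (fun k => (L%:E < Per (H k))%E) k0 Lk0).
have [] : (L%:E < Per (H m))%E /\ forall j, (L%:E < Per (H j))%E -> (m <= j)%N.
  by rewrite /m; case: ex_minnP => j ? ?; split.
case: m => [|m] Lm minm; first by move: PF; rewrite ltNge (ltW Lm).
have Lm' : (Per (H m) <= L%:E)%E by rewrite leNgt; apply/negP => /minm; rewrite ltnn.
have [t /andP[t0 tr] PL] := fill_ball_perimeter (c m) (H m) L (r m) n2
  (measurable_fill_balls F c r mF m) (r0 m) Lm' Lm.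
exists (H m `|` eball (c m) t); split => //.
- by apply: leb_measurableU; [exact: measurable_fill_balls|exact: measurable_eball].
- by move=> x Fx; left; exact: sub_fill_balls.
- move=> x [|tx]; first exact: fill_balls_sub.
  by apply: (rG m); apply: subset_eball tx => //; exact: ltW.
- apply: leb_lty_sub (leb_fill_balls_lty F c r mF m.+1 finF).
  by apply: setUS; apply: subset_eball => //; exact: ltW.
Qed.

Lemma Per_le_null_setD A B : leb_measurable A -> leb_measurable B -> A `<=` B ->
  mu (B `\` A) = 0%E -> (Per B <= Per A)%E.
Proof.
move=> mA mB AB AB0; apply: (Per_le _ _ mB) => phi tphi.
have [M MP] := divergence_bounded phi tphi.
apply: le_trans (le_Per _ _ tphi mA); rewrite lee_fin.
apply: le_trans (div_int_le_setD _ _ _ M tphi mA mB _ MP AB) _; first by rewrite AB0.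
by rewrite AB0 mulr0 addr0.
Qed.

Lemma bigcup_eball c (r : R) : 0 <= r -> \bigcup_k eball c (r + k%:R) = setT.
Proof.
move=> r0; apply/seteqP; split=> // x _; exists (Num.truncn (sqdist c x)).+1 => //.
rewrite /eball/=; have := truncnS_gt (sqdist c x); set k : R := _%:R => h.
have k1 : 1 <= k by rewrite /k ler1n.
by nra.
Qed.

Lemma leb_cut_le c (s t : R) E : leb_measurable E -> 0 <= s -> s <= t ->
  (mu (E `&` eball c t) <= mu (E `&` eball c s) + mu (E `&` (eball c t `\` eball c s)))%E.
Proof.
move=> mE s0 st.
have mB u : leb_measurable (eball c u) by exact: measurable_eball.
apply: le_trans (_ : (mu (E `&` eball c s `|` E `&` (eball c t `\` eball c s)) <= _)%E).
  apply: le_leb => x [Ex tx].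
  by have [sx|sx] := pselect (eball c s x); [left|right].
by apply: (@measureU2 _ _ _ (leb R n)); apply: leb_measurableI => //; exact: leb_measurableD.
Qed.

(** Some larger ball captures more volume of [E]; the part between the two balls then has positive
    volume, and the gain in [Per_setI_eball] is positive. *)
Lemma Per_cut_lt c (r : R) E : (2 <= n)%N -> leb_measurable E -> (mu E < +oo)%E ->
  (Per E < +oo)%E -> 0 < r -> (mu (E `&` eball c r) < mu E)%E ->
  (Per (E `&` eball c r) < Per E)%E.
Proof.
move=> n2 mE finE PE r0 rE.
have mB s : leb_measurable (eball c s) by exact: measurable_eball.
pose H k := E `&` eball c (r + k%:R).
have mH k : leb_measurable (H k) by exact: leb_measurableI.
have sH k : H k `<=` H k.+1.
  apply: setIS; apply: subset_eball; first by rewrite addr_ge0// ltW.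
  by rewrite lerD2l ler_nat.
have HE : \bigcup_k H k = E by rewrite -setI_bigcupr bigcup_eball ?setIT// ltW.
have [k rk] : exists k, (mu (E `&` eball c r) < mu (H k))%E.
  by apply: (increasing_union_volume _ _ mH sH); rewrite HE.
have rrho : r <= r + k%:R by rewrite lerDl.
have V0 : (0 < mu (E `&` (eball c (r + k%:R) `\` eball c r)))%E.
  rewrite lt_neqAle leb_ge0 andbT; apply/eqP => e.
  have := leb_cut_le c r (r + k%:R) E mE (ltW r0) rrho.
  by rewrite -e adde0 leNgt rk.
have P := Per_setI_eball c r (r + k%:R) E n2 mE finE r0 rrho.
apply: lt_le_trans P; rewrite lteDl.
  rewrite mule_gt0// lte_fin divr_gt0// exprn_gt0//; exact: lt_le_trans rrho.
(* Adding a positive amount is strict only to a finite perimeter, so finiteness remains to be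
   shown. *)
have mEr : leb_measurable (E `&` eball c r) by exact: leb_measurableI.
rewrite ge0_fin_numE ?Per_ge0//; apply: le_lt_trans PE.
apply: le_trans (Per_setI_eball c r (r + k%:R) E n2 mE finE r0 rrho).
rewrite leeDl// mule_ge0 ?leb_ge0// lee_fin divr_ge0// exprn_ge0//; first exact: ltW.
exact: le_trans (ltW r0) rrho.
Qed.

(** The volume of the trace is continuous in the radius because thin shells have small volume;
    radius 0 is separate, [eball_shell] requiring a positive one. *)
Lemma cut_ball_volume c (a b : R) E : (2 <= n)%N -> leb_measurable E -> 0 <= b ->
  0 <= a -> (a%:E < mu (E `&` eball c b))%E ->
  exists2 t, 0 <= t < b & mu (E `&` eball c t) = a%:E.
Proof.
move=> n2 mE b0 a0 ab.
have mB u : leb_measurable (eball c u) by exact: measurable_eball.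
have mono u v : 0 <= u -> u <= v -> E `&` eball c u `<=` E `&` eball c v.
  by move=> u0 uv; apply: setIS; exact: subset_eball.
apply: (ereal_semicontinuous_ivt _ (fun t => mu (E `&` eball c t))) => //.
- by rewrite eball0 setI0 measure0 lee_fin.
- move=> t /andP[t0 tb] H; apply/lee_addgt0Pr => d d0.
  have [s [s0 st fs sd]] := eball_left_approx c t d _ t0 d0 H.
  apply: le_trans (leb_cut_le c s t E mE (ltW s0) (ltW st)) _.
  apply: leeD; first exact: fs.
  by apply: le_trans sd; apply: le_leb; exact: subIsetr.
- move=> t d /andP[t0 tb] d0.
  have [t00|tpos] := eqVneq t 0.
    rewrite {}t00 in tb t0 *.
    set V := fine (mu (eball c 1)).
    have V0 : 0 <= V by rewrite fine_ge0// leb_ge0.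
    have nV : 0 < V + 1 by rewrite ltr_wpDl.
    pose s := Num.min b (Num.min 1 (d / (V + 1))).
    have s0 : 0 < s by rewrite !lt_min tb ltr01 divr_gt0.
    have sb : s <= b by rewrite ge_min lexx.
    have s1 : s <= 1 by rewrite !ge_min lexx orbT.
    have sd : s <= d / (V + 1) by rewrite !ge_min lexx !orbT.
    exists s; first by rewrite s0 sb.
    rewrite eball0 setI0 measure0 add0e.
    apply: (@le_trans _ _ (mu (eball c s))); first by apply: le_leb; exact: subIsetr.
    rewrite -(EFin_fine_leb _ (leb_eball_lty c s)) lee_fin.
    apply: (le_trans (leb_eball_le_sqr c s n2 s0 s1)); rewrite -/V.
    have h : s * (V + 1) <= d by rewrite -ler_pdivlMr.
    have h2 : s ^+ 2 * V <= s * V by rewrite ler_wpM2r// expr2 ler_piMr// ltW.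
    by lra.
  have {}t0 : 0 < t by rewrite lt_neqAle eq_sym tpos.
  have [s1 [ts1 _ fin sd]] := eball_shell c t d t0 d0.
  pose s := Num.min b s1.
  have ts : t < s by rewrite lt_min tb ts1.
  have sb : s <= b by rewrite ge_min lexx.
  have ss1 : s <= s1 by rewrite ge_min lexx orbT.
  exists s; first by rewrite ts sb.
  apply: le_trans (leb_cut_le c t s E mE (ltW t0) (ltW ts)) _; rewrite leeD2l//.
  have sub : E `&` (eball c s `\` eball c t) `<=` eball c s1 `\` eball c t.
    move=> x [_ [sx tx]]; split; last exact: tx.
    by apply: subset_eball sx => //; exact: ltW (lt_trans t0 ts).
  rewrite -(EFin_fine_leb _ (leb_lty_sub _ _ sub fin)) lee_fin.
  exact: le_trans (fine_leb_le _ _ sub fin) sd.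
Qed.

Lemma exists_ball_cut c E (a : R) : (2 <= n)%N -> leb_measurable E -> 0 < a ->
  (a%:E < mu E)%E -> exists2 t, 0 < t & mu (E `&` eball c t) = a%:E.
Proof.
move=> n2 mE a0 aE.
have mB u : leb_measurable (eball c u) by exact: measurable_eball.
pose H k := E `&` eball c (0 + k%:R).
have mH k : leb_measurable (H k) by exact: leb_measurableI.
have sH k : H k `<=` H k.+1.
  by apply: setIS; apply: subset_eball; rewrite !add0r// ler_nat.
have [k ak] : exists k, (a%:E < mu (H k))%E.
  by apply: (increasing_union_volume _ _ mH sH); rewrite -setI_bigcupr bigcup_eball ?setIT.
have k0 : (0 : R) <= 0 + k%:R by rewrite add0r.
have [t /andP[t0 _] ta] := cut_ball_volume c a (0 + k%:R) E n2 mE k0 (ltW a0) ak.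
(* Radius 0 is excluded since the empty trace has volume 0 < a. *)
exists t => //; rewrite lt_neqAle t0 andbT; apply/eqP => te.
move: ta; rewrite -te eball0 setI0 measure0 => /eqP; rewrite eqe => /eqP e.
by move: a0; rewrite -e ltxx.
Qed.

Lemma exists_subset_Per_lt E (a : R) : (2 <= n)%N -> leb_measurable E -> (mu E < +oo)%E ->
  (Per E < +oo)%E -> 0 <= a -> (a%:E < mu E)%E ->
  exists E', [/\ leb_measurable E', E' `<=` E, mu E' = a%:E & (Per E' < Per E)%E].
Proof.
move=> n2 mE finE PE a0 aE.
have mEB t : leb_measurable (E `&` eball 0 t).
  by apply: leb_measurableI => //; exact: measurable_eball.
have cut b : 0 < b -> (b%:E < mu E)%E -> exists E',
    [/\ leb_measurable E', E' `<=` E, mu E' = b%:E & (Per E' < Per E)%E].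
  move=> b0 bE; have [t t0 tb] := exists_ball_cut 0 E b n2 mE b0 bE.
  exists (E `&` eball 0 t); split; [exact: mEB|exact: subIsetl|exact: tb|].
  by apply: (Per_cut_lt 0 t E n2 mE finE PE t0); rewrite tb.
have [a00|a_neq0] := eqVneq a 0; last first.
  by apply: cut => //; rewrite lt_neqAle eq_sym a_neq0.
have E0 : 0 < fine (mu E).
  by rewrite -lte_fin (EFin_fine_leb _ finE); apply: le_lt_trans aE; rewrite lee_fin.
(* For a = 0 the empty set works: the perimeter of [E] strictly exceeds that of a half-volume cut,
   hence is positive. *)
have [||E' [mE' _ _ PE']] := cut (fine (mu E) / 2).
- by rewrite divr_gt0.
- by rewrite -[X in (_ < X)%E](EFin_fine_leb _ finE) lte_fin; lra.
exists set0; split; [exact: measurable0|exact: sub0set|by rewrite a00 measure0|].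
rewrite Per0; exact: le_lt_trans (Per_ge0 _ mE') PE'.
Qed.

(** A finite union of balls in [G] has finite perimeter and, with enough balls, volume above a; a
    subset of volume a and smaller perimeter is then taken from it. *)
Lemma exists_finite_Per_subset G (a : R) : (2 <= n)%N -> open G -> 0 <= a ->
  (a%:E < mu G)%E ->
  exists E, [/\ leb_measurable E, E `<=` G, mu E = a%:E & (Per E < +oo)%E].
Proof.
move=> n2 oG a0 aG.
have [c [r [r0 rG Gr]]] := open_eball_cover G oG.
have m0 : leb_measurable (set0 : set 'rV[R]_n) by exact: measurable0.
pose H := fill_balls set0 c r.
have HG : \bigcup_k H k = G.
  rewrite bigcup_fill_balls set0U; apply/seteqP; split=> // x [k _]; exact: rG.
have [k ak] : exists k, (a%:E < mu (H k))%E.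
  apply: (increasing_union_volume _ _ (measurable_fill_balls _ c r m0) (fill_balls_subS _ c r)).
  by rewrite HG.
have finH : (mu (H k) < +oo)%E by apply: (leb_fill_balls_lty _ c r m0); rewrite measure0.
have PH : (Per (H k) < +oo)%E by apply: (Per_fill_balls_lty _ c r m0 _ r0); rewrite Per0.
have mH : leb_measurable (H k) by exact: measurable_fill_balls.
have [E [mE EH Ea PE]] := exists_subset_Per_lt (H k) a n2 mH finH PH a0 ak.
exists E; split; [exact: mE| |exact: Ea|exact: lt_trans PE PH].
by apply: (subset_trans EH); exact: fill_balls_sub.
Qed.

End strict_cut.

(** * Passing between the two variational problems *)

Theorem theorem2p1 (R : realType) (n : nat) (hn : (2 <= n)%N)
    (G : set 'rV[R]_n) (oG : open G) (hG : leb R n (boundary G) = 0%E) :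
  (forall (L : R) (E : set 'rV[R]_n),
    0 <= L -> (L%:E < Per G)%E -> solution_P G L E ->
    forall F : set 'rV[R]_n, competitor G F -> leb R n F = leb R n E ->
      (Per E <= Per F)%E) /\
  (forall (A : R) (F : set 'rV[R]_n),
    0 <= A -> (A%:E < leb R n G)%E -> solution_Pstar G A F ->
    forall E : set 'rV[R]_n, competitor G E -> Per E = Per F ->
      (leb R n E <= leb R n F)%E).
Proof.
have clG (E : set 'rV[R]_n) : E `<=` G -> E `<=` closure G.
  by move=> EG; apply: (subset_trans EG); exact: subset_closure.
split=> [L E L0 LG [_ PE maxE] F [mF FG finF] volF|A F A0 AG [_ volF minF] E [mE EG finE] PEF].
(* A competitor [F] with Per F < L is enlarged to [F'] of perimeter L. Maximality of [E] forces the
   added part to be null, and a null set cannot raise the perimeter to L. *)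
- rewrite leNgt; apply/negP; rewrite PE => PF.
  have [F' [mF' FF' F'G finF' PF']] := exists_superset_Per G F L hn oG mF FG finF PF LG.
  have volF' : (leb R n F' <= leb R n F)%E.
    by rewrite volF; apply: maxE => //; split=> //; exact: clG.
  have null : leb R n (F' `\` F) = 0%E.
    have mD := leb_measurableD _ _ mF' mF.
    apply/eqP; rewrite eq_le leb_ge0 andbT.
    move: volF'; rewrite -{1}(setDUK FF') (lebU _ _ mF mD (setDIK _ _)).
    rewrite -[leb R n F](EFin_fine_leb _ finF) -[X in (_ <= X)%E]adde0.
    by rewrite leeD2lE.
  have := Per_le_null_setD _ _ mF mF' FF' null.
  by rewrite PF' leNgt PF.
(* If [E] had volume above A, it would contain a subset of volume A with perimeter below Per F,
   against minimality. The strict decrease needs Per F to be finite, which is obtained first by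
   comparison. *)
- rewrite leNgt volF; apply/negP => AE.
  have PF : (Per F < +oo)%E.
    have [H [mH HG volH PH]] := exists_finite_Per_subset G A hn oG A0 AG.
    apply: le_lt_trans PH; apply: minF => //.
    by split; [exact: mH|exact: clG|rewrite volH ltry].
  have PE : (Per E < +oo)%E by rewrite PEF.
  have [E' [mE' E'E volE' PE']] := exists_subset_Per_lt E A hn mE finE PE A0 AE.
  move: PE'; rewrite PEF ltNge => /negP; apply; apply: minF => //.
  by split; [exact: mE'|apply: clG; exact: subset_trans EG|rewrite volE' ltry].
Qed.
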